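(* Let $Y\subseteq\mathbb{R}^d$ be open with Lebesgue measure $|Y|$, let $0<T<\infty$, $f_I\in L^2(Y)$, $\sigma\in C^{0,1}(\mathbb{R})$ with $|\sigma(0)|\,|Y|<\infty$, $a\in L^1((0,T);L^2(Y))$ and $b\in L^1((0,T);L^2(Y\times Y))$. Then the initial-value problem $$\partial_t f(y,t)=\sigma\Big(a(y,t)-\int_Y b(y,z,t)f(z,t)\,dz\Big)\quad (y\in Y,\ t\in[0,T]),\qquad f(y,0)=f_I(y)\quad (y\in Y)$$ has a unique solution $f$ in $C([0,T];L^2(Y))$. This solution depends uniformly Lipschitz-continuously on the initial datum $f_I\in L^2(Y)$ and locally Lipschitz-continuously on the parameters $(a,b)\in L^1((0,T);L^2(Y))\times L^1((0,T);L^2(Y\times Y))$, as an element of $C([0,T];L^2(Y))$.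
   Context: $C^{0,1}(\mathbb{R})$ denotes the uniformly (globally) Lipschitz-continuous functions $\mathbb{R}\to\mathbb{R}$. In the condition $|\sigma(0)|\,|Y|<\infty$ the convention $0\cdot\infty=0$ is used. A solution is a function $f\in C([0,T];L^2(Y))$ satisfying the integrated equation $f(y,t)=f_I(y)+\int_0^t\sigma\big(a(y,s)-\int_Y b(y,z,s)f(z,s)\,dz\big)\,ds$ for all $t\in[0,T]$. ''Uniformly Lipschitz-continuously on the initial datum'' means that for fixed $(a,b)$ the map $f_I\mapsto f$, $L^2(Y)\to C([0,T];L^2(Y))$, is Lipschitz with a constant that does not depend on $f_I$; ''locally Lipschitz-continuously on the parameters'' means that for fixed $f_I$ the map $(a,b)\mapsto f$ is locally Lipschitz. *)

(* Defs.v *)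
From HB Require Import structures.
From mathcomp Require Import all_boot all_order all_algebra.
From mathcomp Require Import all_classical all_reals all_analysis.

Set Implicit Arguments.
Unset Strict Implicit.
Unset Printing Implicit Defensive.
Import Order.TTheory GRing.Theory Num.Theory.
Import numFieldNormedType.Exports.
Local Open Scope classical_set_scope.
Local Open Scope ring_scope.

Definition rV_display : measure_display. Proof. exact: default_measure_display. Qed.

Section rV_measurable.
Context {R : realType} (n : nat).

Definition rV_coor (i : 'I_n) (v : 'rV[R]_n) : measurableTypeR R := v ord0 i.

Let rV_set0 : g_sigma_preimage rV_coor set0.
Proof. exact: sigma_algebra0. Qed.

Let rV_setC A : g_sigma_preimage rV_coor A -> g_sigma_preimage rV_coor (~` A).
Proof. exact: sigma_algebraC. Qed.

Let rV_bigcup (F : _^nat) : (forall i, g_sigma_preimage rV_coor (F i)) ->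
  g_sigma_preimage rV_coor (\bigcup_i (F i)).
Proof. exact: sigma_algebra_bigcup. Qed.

(* The product sigma-algebra on R^n; [open_measurable_rV] below shows that it
   contains the open sets, so that it is the Borel sigma-algebra. *)
HB.instance Definition _ := @isMeasurable.Build rV_display
  'rV[R]_n (g_sigma_preimage rV_coor) rV_set0 rV_setC rV_bigcup.

Lemma measurable_rV_coor i :
  measurable_fun [set: 'rV[R]_n] (rV_coor i).
Proof.
move=> _ Y mY; rewrite setTI; apply: sub_sigma_algebra => /=.
rewrite -bigcup_seq/=; exists i => /=; first by rewrite mem_index_enum.
by exists Y => //; rewrite setTI.
Qed.

Lemma measurable_fun_rVP d (X : measurableType d) (f : X -> 'rV[R]_n) :
  (forall i, measurable_fun [set: X] (rV_coor i \o f)) ->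
  measurable_fun [set: X] f.
Proof.
move=> mf _ B mB; rewrite setTI.
have : preimage_set_system [set: X] f (g_sigma_preimage rV_coor) `<=` measurable.
  rewrite -g_sigma_preimage_comp.
  apply: smallest_sub; first exact: sigma_algebra_measurable.
  move=> A; rewrite -bigcup_seq => -[i _] [C mC <-].
  exact: mf.
by apply; exists B => //; rewrite setTI.
Qed.

Lemma open_measurable_rV (Y : set 'rV[R]_n) : open Y -> measurable Y.
Proof.
move=> oY.
pose box (p : {ffun 'I_n -> rat * rat}) : set 'rV[R]_n :=
  [set v | forall i, ratr (p i).1 < v ord0 i < ratr (p i).2].
pose B (k : nat) : set 'rV[R]_n :=
  if unpickle k is Some p then if pselect (box p `<=` Y) then box p else set0
  else set0.
have mbox p : measurable (box p).
  have -> : box p = \big[setI/setT]_(i < n)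
      (rV_coor i @^-1` `](ratr (p i).1 : R), (ratr (p i).2 : R)[%classic).
    rewrite -bigcap_seq; apply/seteqP; split => [v pv i _ /=|v pv i].
      by rewrite in_itv/=; exact: pv.
    by have := pv i (mem_index_enum i); rewrite /= in_itv.
  apply: bigsetI_measurable => i _.
  rewrite -[X in measurable X]setTI.
  exact: (measurable_rV_coor i measurableT (measurable_itv _)).
have -> : Y = \bigcup_k B k.
  apply/seteqP; split => [v Yv|v [k _]]; last first.
    by rewrite /B; case: unpickle => // p; case: pselect => //= pY /pY.
  have /nbhs_ballP[e /= e0 veY] : nbhs v Y by exact: open_nbhs_nbhs.
  have H i : exists q : rat * rat,
      ratr q.1 < v ord0 i < ratr q.2 /\
      (v ord0 i - e < ratr q.1 /\ ratr q.2 < v ord0 i + e).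
    have [q1] := @rat_in_itvoo R (v ord0 i - e) (v ord0 i) ltac:(by rewrite ltrBlDr ltrDl).
    have [q2] := @rat_in_itvoo R (v ord0 i) (v ord0 i + e) ltac:(by rewrite ltrDl).
    rewrite !in_itv/= => /andP[? ?] /andP[? ?].
    by exists (q1, q2); split; [apply/andP|]; split.
  have [p pP] := choice H.
  exists (pickle [ffun i => p i]) => //.
  rewrite /B pickleK; case: pselect => /= [_|].
    by move=> i; rewrite ffunE; have [] := pP i.
  case=> w bw; apply: veY; split => // i j; rewrite (ord1 i).
  have := bw j; rewrite ffunE => /andP[w1 w2].
  have [_ [w3 w4]] := pP j.
  rewrite /ball/= ltr_distlC.
  by rewrite (lt_trans w3 w1) (lt_trans w2 w4).
apply: bigcupT_measurable => k; rewrite /B.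
by case: unpickle => [p|]; [case: pselect => _ /=; [exact: mbox|]|]; exact: measurable0.
Qed.

End rV_measurable.

(* MathComp-Analysis proves this, but the sigma-finite structure of a general
   product measure cannot be inferred: the canonical key [product_measure1] is
   taken by the product of subprobabilities. *)
Lemma product_sigma_finite d1 d2 (T1 : measurableType d1)
    (T2 : measurableType d2) (R : realType)
    (m1 : {sigma_finite_measure set T1 -> \bar R})
    (m2 : {sigma_finite_measure set T2 -> \bar R}) :
  sigma_finite setT (m1 \x m2)%E.
Proof.
have /sigma_finiteP[F [TF ndF Foo]] := sigma_finiteT m1.
have /sigma_finiteP[G [TG ndG Goo]] := sigma_finiteT m2.
exists (fun n => F n `*` G n).
  rewrite -setXTT TF TG predeqE => -[x y]; split.
    move=> [/= [n _ Fnx] [k _ Gky]]; exists (maxn n k) => //; split.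
    - by move: x Fnx; exact/subsetPset/ndF/leq_maxl.
    - by move: y Gky; exact/subsetPset/ndG/leq_maxr.
  by move=> [n _ []/= ? ?]; split; exists n.
move=> k; have [? ?] := Foo k; have [? ?] := Goo k.
split; first exact: measurableX.
by rewrite product_measure1E// lte_mul_pinfty// ge0_fin_numE.
Qed.

Section lebesgue_rV.
Context {R : realType}.

Definition rV_cons n (x : measurableTypeR R * 'rV[R]_n) : 'rV[R]_n.+1 :=
  row_mx (const_mx x.1 : 'rV[R]_1) x.2.

Definition rV_uncons n (v : 'rV[R]_n.+1) : measurableTypeR R * 'rV[R]_n :=
  (v ord0 ord0, rsubmx (v : 'rV[R]_(1 + n))).

Lemma rV_cons0 n (x : measurableTypeR R * 'rV[R]_n) :
  rV_coor ord0 (rV_cons x) = x.1.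
Proof. by rewrite /rV_coor mxE; case: splitP => // j _; rewrite mxE. Qed.

Lemma rV_consS n (x : measurableTypeR R * 'rV[R]_n) i :
  rV_coor (lift ord0 i) (rV_cons x) = x.2 ord0 i.
Proof.
rewrite /rV_coor mxE; case: splitP => [[[]]//|j /= ij].
by congr (x.2 _ _); apply: val_inj; case: ij.
Qed.

Lemma rV_consK n : cancel (@rV_cons n) (@rV_uncons n).
Proof.
move=> x; rewrite [RHS]surjective_pairing; congr pair; first exact: rV_cons0.
exact: row_mxKr.
Qed.

Lemma measurable_rV_cons n : measurable_fun setT (@rV_cons n).
Proof.
apply: measurable_fun_rVP => i.
case: (unliftP ord0 i) => [j ->|->].
  rewrite (_ : _ \o _ = rV_coor j \o snd).
    by apply: measurableT_comp => //; exact: measurable_rV_coor.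
  by apply/funext => x /=; rewrite rV_consS.
rewrite (_ : _ \o _ = fst)//.
by apply/funext => x /=; rewrite rV_cons0.
Qed.

Lemma measurable_rV_uncons n : measurable_fun setT (@rV_uncons n).
Proof.
apply/measurable_fun_pairP; split.
  exact: (measurable_rV_coor ord0).
apply: measurable_fun_rVP => i.
rewrite (_ : _ \o _ = rV_coor (lift ord0 i)).
  exact: measurable_rV_coor.
apply/funext => v /=; rewrite /rV_coor mxE; congr (v _ _).
exact: val_inj.
Qed.

(* Lebesgue measure on R^n, by induction on n: the image of the product measure
   on R * R^n under (x, v) |-> row_mx x v; on the one-point space R^0 it is the
   Dirac mass. [lebesgue_rV_setX] is the characteristic product formula. *)
Section step.
Variables (n : nat) (mu : {sigma_finite_measure set 'rV[R]_n -> \bar R}).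

Definition lebesgue_rV_step : set 'rV[R]_n.+1 -> \bar R :=
  pushforward (@lebesgue_measure R \x mu)%E (@rV_cons n).

Let step0 : lebesgue_rV_step set0 = 0%E.
Proof. by rewrite /lebesgue_rV_step /pushforward preimage_set0 measure0. Qed.

Let step_ge0 A : (0 <= lebesgue_rV_step A)%E.
Proof. exact: (measure_ge0 (@lebesgue_measure R \x mu)%E). Qed.

Let step_sigma_additive : semi_sigma_additive lebesgue_rV_step.
Proof.
have mf := @measurable_rV_cons n.
pose m := measure_function_pushforward__canonical__measure_function_Measure
  (@lebesgue_measure R \x mu)%E mf.
exact: (@measure_semi_sigma_additive _ _ _ m).
Qed.

HB.instance Definition _ := isMeasure.Build _ _ _ lebesgue_rV_step
  step0 step_ge0 step_sigma_additive.

Let step_sigma_finite : sigma_finite setT lebesgue_rV_step.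
Proof.
have [F FT mF] : sigma_finite setT (@lebesgue_measure R \x mu)%E.
  exact: product_sigma_finite.
exists (fun k => @rV_uncons n @^-1` F k).
  by rewrite -preimage_bigcup -FT.
move=> k; have [mFk Fkoo] := mF k; split.
  by rewrite -[X in measurable X]setTI; exact: measurable_rV_uncons.
rewrite /lebesgue_rV_step /pushforward -comp_preimage.
rewrite (_ : _ \o _ = id)//.
by apply/funext => x /=; rewrite rV_consK.
Qed.

HB.instance Definition _ := Measure_isSigmaFinite.Build _ _ _ lebesgue_rV_step
  step_sigma_finite.

End step.

Fixpoint lebesgue_rV n : {sigma_finite_measure set 'rV[R]_n -> \bar R} :=
  match n return {sigma_finite_measure set 'rV[R]_n -> \bar R} with
  | 0 => dirac (0 : 'rV[R]_0)
  | m.+1 => lebesgue_rV_step (lebesgue_rV m)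
  end.

Let measurable_setXrV n (A : 'I_n -> set (measurableTypeR R)) :
  (forall i, measurable (A i)) ->
  measurable [set v : 'rV[R]_n | forall i, A i (rV_coor i v)].
Proof.
move=> mA; have -> : [set v : 'rV[R]_n | forall i, A i (rV_coor i v)] =
    \big[setI/setT]_(i < n) (rV_coor i @^-1` A i).
  rewrite -bigcap_seq; apply/seteqP; split => [v Av i _ //|v Av i].
  exact: Av i (mem_index_enum i).
apply: bigsetI_measurable => i _.
by rewrite -[X in measurable X]setTI; exact: measurable_rV_coor.
Qed.

Lemma lebesgue_rV_setX n (A : 'I_n -> set (measurableTypeR R)) :
  (forall i, measurable (A i)) ->
  lebesgue_rV n [set v | forall i, A i (rV_coor i v)] =
  (\prod_(i < n) lebesgue_measure (A i))%E.
Proof.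
elim: n A => [|n ih] A mA.
  rewrite big_ord0 /= diracE mem_set//= => -[]//.
rewrite big_ord_recl -ih//=.
rewrite -(product_measure1E (@lebesgue_measure R) (lebesgue_rV n))//; last first.
  by apply: (measurable_setXrV (fun i => mA (lift ord0 i))).
rewrite /lebesgue_rV_step /pushforward; congr (_ _).
apply/seteqP; split => [[x v] /= Axv|[x v] /= [Ax Av] i].
  split; first by have := Axv ord0; rewrite rV_cons0.
  by move=> i; have := Axv (lift ord0 i); rewrite rV_consS.
by case: (unliftP ord0 i) => [j ->|->]; rewrite ?rV_consS ?rV_cons0//; exact: Av.
Qed.

End lebesgue_rV.

(* Lebesgue measure on Y, as a measure on R^d that gives no mass to the
   complement of Y. An element of L^2(Y) is represented by a function on R^d in
   [Lfun (lebesgue_on oY) 2] (only its restriction to Y matters, up to a.e.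
   equality), an element of L^2(Y * Y) by a function on R^d * R^d in
   [Lfun (lebesgue_on oY \x lebesgue_on oY) 2]. *)
Section lebesgue_on.
Context {R : realType} (d : nat) (Y : set 'rV[R]_d) (oY : open Y).

Definition lebesgue_on : set 'rV[R]_d -> \bar R :=
  mrestr (lebesgue_rV d) (open_measurable_rV oY).

HB.instance Definition _ := Measure.on lebesgue_on.

Let lebesgue_on_sigma_finite : sigma_finite setT lebesgue_on.
Proof.
have [F FT mF] := sigma_finiteT (@lebesgue_rV R d).
exists F => // k; have [mFk Fkoo] := mF k; split => //.
apply: le_lt_trans Fkoo; rewrite /lebesgue_on /mrestr.
apply: le_measure; rewrite ?inE//.
by apply: measurableI => //; exact: open_measurable_rV.
Qed.

HB.instance Definition _ := Measure_isSigmaFinite.Build _ _ _ lebesgue_on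
  lebesgue_on_sigma_finite.

End lebesgue_on.

(* Curves with values in L^2(nu), that is, functions of t whose values are
   representatives of elements of L^2(nu). All notions below are expressed by
   the L^2 seminorm, so that they do not depend on the chosen representative of
   each u t. *)
Section Bochner.
Context {R : realType} d (X : measurableType d).
Variable nu : {measure set X -> \bar R}.
Implicit Types (D : set R) (u : R -> X -> R) (T : R).

Definition L2norm (h : X -> R) : \bar R := 'N[nu]_2%:E[EFin \o h]%E.

Definition simple_curve u := exists n (A : 'I_n -> set R) (h : 'I_n -> X -> R),
  [/\ forall i, measurable (A i) /\ (lebesgue_measure (A i) < +oo)%E,
      forall i, h i \in Lfun nu 2%:E &
      u = (fun t x => \sum_(i < n) \1_(A i) t * h i x)].

(* An element of L^1(D; L^2(nu)) is a class of a.e. equal curves; it is taken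
   here through a representative that is the limit of simple curves everywhere
   on D, which always exists. The norm t |-> L2norm (u t) is then a Borel
   function on D. *)
Definition strongly_measurable D u :=
  (forall t, D t -> u t \in Lfun nu 2%:E) /\
  exists s : nat -> R -> X -> R, (forall k, simple_curve (s k)) /\
    (forall t, D t -> L2norm (u t \- s k t) @[k --> \oo] --> 0%E).

Definition L1L2norm D u : \bar R :=
  (\int[lebesgue_measure]_(t in D) L2norm (u t))%E.

Definition in_L1L2 D u := strongly_measurable D u /\ (L1L2norm D u < +oo)%E.

(* v is the L^2(nu)-valued integral of u over D. The integral over D of the
   simple curve \sum_i \1_(A i) h_i is \sum_i lebesgue_measure (A i `&` D) h_i,
   which is its integral in t at fixed x. *)
Definition is_Bochner_integral D u (v : X -> R) :=
  [/\ strongly_measurable D u, v \in Lfun nu 2%:E &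
  exists s : nat -> R -> X -> R, [/\ forall k, simple_curve (s k),
    L1L2norm D (fun t => u t \- s k t) @[k --> \oo] --> 0%E &
    L2norm ((fun x => \int[lebesgue_measure]_(t in D) s k t x) \- v)
      @[k --> \oo] --> 0%E]].

Definition in_CL2 T u :=
  (forall t, t \in `[0, T] -> u t \in Lfun nu 2%:E) /\
  (forall t, t \in `[0, T] ->
    L2norm (u s \- u t) @[s --> within `[0, T]%classic (nbhs t)] --> 0%E).

(* The norm of C([0, T]; L^2(nu)). *)
Definition CL2norm T u : \bar R :=
  ereal_sup [set L2norm (u t) | t in `[0, T]%classic].

End Bochner.

Section ivp.
Context {R : realType} (d : nat) (Y : set 'rV[R]_d) (oY : open Y).
Local Notation muY := (lebesgue_on oY).
Local Notation muYY := (muY \x muY)%E.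

Definition in_params (T : R) (a : R -> 'rV[R]_d -> R)
    (b : R -> 'rV[R]_d * 'rV[R]_d -> R) :=
  in_L1L2 muY `]0, T[%classic a /\ in_L1L2 muYY `]0, T[%classic b.

(* The norm of L^1((0, T); L^2(Y)) * L^1((0, T); L^2(Y * Y)). *)
Definition params_norm (T : R) (a : R -> 'rV[R]_d -> R)
    (b : R -> 'rV[R]_d * 'rV[R]_d -> R) : \bar R :=
  (L1L2norm muY `]0%R, T[%classic a + L1L2norm muYY `]0%R, T[%classic b)%E.

Definition ivp_rhs (sigma : R -> R) (a : R -> 'rV[R]_d -> R)
    (b : R -> 'rV[R]_d * 'rV[R]_d -> R) (f : R -> 'rV[R]_d -> R) :
    R -> 'rV[R]_d -> R :=
  fun s y => sigma (a s y - \int[muY]_z (b s (y, z) * f s z)).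

(* f - fI is the integral over (0, t) of the right-hand side as an element of
   L^2(Y): the values of a and b at a given time are only defined almost
   everywhere in space, so that the time integral is that of L^2(Y)-valued
   curves, not of real functions at fixed y. *)
Definition is_solution (T : R) sigma a b (fI : 'rV[R]_d -> R)
    (f : R -> 'rV[R]_d -> R) :=
  in_CL2 muY T f /\
  forall t, t \in `[0, T] ->
    is_Bochner_integral muY `]0, t[%classic (ivp_rhs sigma a b f) (f t \- fI).

End ivp.

(* Main.v *)
Require Import Defs.
From HB Require Import structures.
From mathcomp Require Import all_boot all_order all_algebra.
From mathcomp Require Import all_classical all_reals all_analysis.
From mathcomp Require Import measurable_realfun ring lra.
Set Implicit Arguments.
Unset Strict Implicit.
Unset Printing Implicit Defensive.
Import Order.TTheory GRing.Theory Num.Theory.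
Import numFieldNormedType.Exports.
Local Open Scope classical_set_scope.
Local Open Scope ring_scope.

(** Write the problem as an integral equation in L^2(Y),
    f(t) = f_I + int_0^t F(s, f(s)) ds, with
    F(s, p) = sigma o (a(s) - K_b(s) p), where K_b is the integral operator with
    kernel b. By the Cauchy-Schwarz inequality and Tonelli's theorem, K_b is
    bounded on L^2(Y) by the norm of b ([kernel_op_bound]), so that F is
    Lipschitz in its second argument with a constant
    beta(s) = L |b(s)| that is integrable in time, L being a Lipschitz constant
    of sigma ([ivp_field_sub]). The condition on sigma(0) puts the constant
    sigma(0) in L^2(Y); as a is integrable in time, so is F(s, 0). The theorem is
    then an instance of the Caratheodory theory of such equations.

    The integral is a Bochner integral. Existence of the integral of a strongly
    measurable curve with integrable norm ([Bochner_exists]) rests on the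
    completeness of L^2 ([L2_complete]) and on dominated convergence; the norm of
    the integral is at most the integral of the norm ([L2norm_Bochner]); the
    indefinite integral is continuous ([Bochner_primitive]). Simple curves are
    handled in the form g o c, where c is a measurable map from the time line to
    a finite type: this form is stable under every operation on values, and in
    particular under the nonlinear superposition with sigma.

    The quantitative core is the weight w(t) = exp(4 int_0^t beta), which
    satisfies int_0^t beta w <= w(t) / 2 ([weight_exists]). In the supremum norm
    weighted by 1 / w the integral equation is thus a contraction of ratio 1/2
    ([weight_half]): Picard iteration converges ([evolution_exists]), and a
    Gronwall inequality ([gronwall]) compares two solutions of two such
    equations ([evolution_stability]). Applied to one and the same field this
    gives uniqueness and the Lipschitz dependence on the initial datum, with
    constant 2 exp(4 L |b|). For two pairs of parameters in the unit ball around
    (a, b), the fields differ along the first solution by at most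
    L (|a1 - a2| + M |b1 - b2|), where M bounds all the solutions with parameters
    in that ball ([ivp_bound]). *)

Local Arguments L2norm {R d X} nu h%_ring_scope.

(** * Limits of extended real functions *)

Section ereal_limits.
Context {R : realType}.

Lemma cvg_EFin_comp T (F : set_system T) {FF : Filter F} (u : T -> R) (l : R) :
  u x @[x --> F] --> l -> (u x)%:E @[x --> F] --> l%:E.
Proof. by move=> ul; apply: cvg_EFin => //; exact: nearW. Qed.

Lemma cvge0P T (F : set_system T) {FF : Filter F} (u : T -> \bar R) :
  (forall x, (0 <= u x)%E) ->
  (u x @[x --> F] --> 0%E) <->
  (forall e : R, 0 < e -> \forall x \near F, (u x <= e%:E)%E).
Proof.
move=> u0; split => [/fine_cvgP[ufin ucvg] e e0|ue].
  near=> x; have ux : u x \is a fin_num by near: x.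
  rewrite -(fineK ux) lee_fin -[leLHS]ger0_norm ?fine_ge0//.
  rewrite -[fine _]subr0 distrC; near: x.
  by move/cvgrPdist_le : ucvg; apply.
apply/fine_cvgP; split.
  near=> x; rewrite ge0_fin_numE//; apply: (@le_lt_trans _ _ 1%:E); last exact: ltry.
  by near: x; exact: ue.
apply/cvgrPdist_le => e e0; near=> x.
rewrite distrC subr0 /= ger0_norm ?fine_ge0//.
have : (u x <= e%:E)%E by near: x; exact: ue.
move=> uxe; rewrite -lee_fin fineK//.
by rewrite ge0_fin_numE//; exact: le_lt_trans uxe (ltry _).
Unshelve. all: by end_near. Qed.

Lemma cvge0_le T (F : set_system T) {FF : Filter F} (u v : T -> \bar R) :
  (forall x, (0 <= u x)%E) -> (\forall x \near F, (u x <= v x)%E) ->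
  v x @[x --> F] --> 0%E -> u x @[x --> F] --> 0%E.
Proof.
move=> u0 uv v0; apply: (@squeeze_cvge _ _ _ _ (cst 0%E) _ v) => //.
  by apply: filterS uv => x ->; rewrite u0.
exact: cvg_cst.
Qed.

Lemma cvge0D T (F : set_system T) {FF : Filter F} (u v : T -> \bar R) :
  u x @[x --> F] --> 0%E -> v x @[x --> F] --> 0%E ->
  (u x + v x)%E @[x --> F] --> 0%E.
Proof. by move=> u0 v0; rewrite -[0%E]adde0; exact: cvgeD. Qed.

Lemma cvge0Zl T (F : set_system T) {FF : Filter F} (c : \bar R) (u : T -> \bar R) :
  c \is a fin_num ->
  u x @[x --> F] --> 0%E -> (c * u x)%E @[x --> F] --> 0%E.
Proof. by move=> cf u0; rewrite -[0%E](mule0 c); exact: cvgeZl. Qed.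

End ereal_limits.

(** * The seminorm of L^2 *)

Section L2_seminorm.
Context {R : realType} {d} {X : measurableType d}.
Variable nu : {measure set X -> \bar R}.
Implicit Types (h k g : X -> R) (c : R).
Local Notation L2 := (Lfun nu 2%:E).
Local Notation N := (L2norm nu).

Lemma L2_measurable h : h \in L2 -> measurable_fun setT h.
Proof. by rewrite inE => /andP[/[!inE]]. Qed.

Lemma L2norm_lty h : h \in L2 -> (N h < +oo)%E.
Proof. by rewrite inE => /andP[_ /[!inE]]. Qed.

Lemma L2P h : measurable_fun setT h -> (N h < +oo)%E -> h \in L2.
Proof. by move=> mh Nh; rewrite inE; apply/andP; split; rewrite inE. Qed.

Lemma L2norm_ge0 h : (0 <= N h)%E.
Proof. exact: Lnorm_ge0. Qed.

Lemma L2norm_fin_num h : h \in L2 -> N h \is a fin_num.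
Proof. by move=> /L2norm_lty Nh; rewrite ge0_fin_numE// L2norm_ge0. Qed.

Lemma L2norm_fineK h : h \in L2 -> (fine (N h))%:E = N h.
Proof. by move=> /L2norm_fin_num Nh; rewrite fineK. Qed.

Lemma L2_add h k : h \in L2 -> k \in L2 -> h \+ k \in L2.
Proof. by have [_] := Lfun_addr_closed nu (@lee1n R 2); apply. Qed.

Lemma L2normN h : N (\- h) = N h.
Proof.
rewrite /L2norm (_ : _ \o _ = \- (EFin \o h))%E//; exact: oppe_Lnorm.
Qed.

Lemma L2_opp h : h \in L2 -> \- h \in L2.
Proof.
move=> hL; apply: L2P; last by rewrite L2normN L2norm_lty.
by apply: measurableT_comp => //; exact: L2_measurable.
Qed.

Lemma L2_sub h k : h \in L2 -> k \in L2 -> h \- k \in L2.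
Proof. by move=> hL kL; exact: L2_add hL (L2_opp kL). Qed.

Lemma L2_cst0 : cst 0 \in L2.
Proof.
apply: L2P; first exact: measurable_cst.
by rewrite /L2norm (_ : _ \o _ = cst 0%E)// Lnorm0// eqe.
Qed.

Lemma fun_subrr U (h : U -> R) : h \- h = cst 0.
Proof. by apply/funext => x /=; rewrite subrr. Qed.

Lemma fun_subr0 U (h : U -> R) : h \- cst 0 = h.
Proof. by apply/funext => x /=; rewrite subr0. Qed.

Lemma L2norm_cst0 : N (cst 0) = 0%E.
Proof. by rewrite /L2norm (_ : _ \o _ = cst 0%E)// Lnorm0// eqe. Qed.

Lemma integral_sqr_ge0 h : (0 <= \int[nu]_x (h x ^+ 2)%:E)%E.
Proof. by apply: integral_ge0 => x _; rewrite lee_fin sqr_ge0. Qed.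

Lemma measurable_sqr h : measurable_fun setT h ->
  measurable_fun setT (fun x => (h x ^+ 2)%:E).
Proof. by move=> mh; apply/measurable_EFinP; exact: measurable_funX. Qed.

Lemma L2norm_sqr h : (N h `^ 2 = \int[nu]_x (h x ^+ 2)%:E)%E.
Proof.
rewrite /L2norm poweR_Lnorm//; apply: eq_integral => x _ /=.
by rewrite powR_mulrn// real_normK// num_real.
Qed.

Lemma L2normE h : (N h = (\int[nu]_x (h x ^+ 2)%:E) `^ 2^-1)%E.
Proof.
by rewrite -L2norm_sqr -poweRrM divff// poweRe1// L2norm_ge0.
Qed.

(** Reduces bounds on the norm to bounds on an integral, to which the
    convergence theorems of integration apply. *)
Lemma L2norm_leP h c : 0 <= c ->
  (N h <= c%:E)%E <-> (\int[nu]_x (h x ^+ 2)%:E <= (c ^+ 2)%:E)%E.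
Proof.
move=> c0; split => [hc|hc].
  rewrite -L2norm_sqr -powR_mulrn// -poweR_EFin.
  by apply: gt0_ler_poweR; rewrite // in_itv/= leey andbT ?L2norm_ge0 ?lee_fin.
rewrite L2normE.
have -> : c%:E = ((c ^+ 2)%:E `^ 2^-1)%E.
  by rewrite -powR_mulrn// poweR_EFin -powRrM divff// powRr1.
apply: gt0_ler_poweR => //.
  by rewrite in_itv/= leey andbT integral_sqr_ge0.
by rewrite in_itv/= leey andbT lee_fin sqr_ge0.
Qed.

Lemma ae_le_L2norm h k : measurable_fun setT h -> measurable_fun setT k ->
  {ae nu, forall x, `|h x| <= `|k x|} -> (N h <= N k)%E.
Proof.
move=> mh mk hk; rewrite !L2normE; apply: gt0_ler_poweR => //.
- by rewrite in_itv/= leey andbT integral_sqr_ge0.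
- by rewrite in_itv/= leey andbT integral_sqr_ge0.
- apply: ae_ge0_le_integral => //.
  + by move=> x _; rewrite lee_fin sqr_ge0.
  + exact: measurable_sqr.
  + by move=> x _; rewrite lee_fin sqr_ge0.
  + exact: measurable_sqr.
  + apply: filterS hk => x hk _; rewrite lee_fin.
    rewrite -(real_normK (num_real (h x))) -(real_normK (num_real (k x))).
    by rewrite ler_sqr ?nnegrE.
Qed.

Lemma le_L2norm h k : measurable_fun setT h -> measurable_fun setT k ->
  (forall x, `|h x| <= `|k x|) -> (N h <= N k)%E.
Proof. by move=> mh mk hk; apply: ae_le_L2norm => //; exact: nearW. Qed.

Lemma ae_eq_L2norm h k : measurable_fun setT h -> measurable_fun setT k ->
  h = k %[ae nu] -> N h = N k.
Proof.
move=> mh mk hk; apply/eqP; rewrite eq_le; apply/andP; split;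
  by apply: ae_le_L2norm => //; apply: filterS hk => x /(_ I) ->.
Qed.

Lemma L2normD h k : h \in L2 -> k \in L2 -> (N (h \+ k) <= N h + N k)%E.
Proof.
move=> hL kL; apply: minkowski_EFin => //; first exact: L2_measurable.
- exact: L2_measurable.
- by rewrite ler1n.
Qed.

Lemma L2normB h k : N (h \- k) = N (k \- h).
Proof.
rewrite -L2normN; congr L2norm; apply/funext => x /=.
by rewrite opprB.
Qed.

Lemma L2norm_subsub h k g : h \in L2 -> k \in L2 -> g \in L2 ->
  (N (h \- k) <= N (h \- g) + N (g \- k))%E.
Proof.
move=> hL kL gL.
have -> : h \- k = (h \- g) \+ (g \- k) by apply/funext => x /=; rewrite addrA subrK.
by apply: L2normD; exact: L2_sub.
Qed.

Lemma L2norm_le_sub h k : h \in L2 -> k \in L2 -> (N h <= N (h \- k) + N k)%E.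
Proof.
move=> hL kL.
have {1}-> : h = (h \- k) \+ k by apply/funext => x /=; rewrite subrK.
by apply: L2normD => //; exact: L2_sub.
Qed.

Lemma L2norm_subD h k : h \in L2 -> k \in L2 -> (N (h \- k) <= N h + N k)%E.
Proof.
move=> hL kL; rewrite -(L2normN k).
apply: L2normD => //; exact: L2_opp.
Qed.

Lemma L2normZ c h : h \in L2 -> N (fun x => c * h x) = (`|c|%:E * N h)%E.
Proof.
move=> hL; rewrite !L2normE.
under eq_integral do rewrite exprMn EFinM.
rewrite ge0_integralZl_EFin ?sqr_ge0//; last 2 first.
- by move=> x _; rewrite lee_fin sqr_ge0.
- by apply: measurable_sqr; exact: L2_measurable.
rewrite poweRM ?integral_sqr_ge0 ?lee_fin ?sqr_ge0//; congr (_ * _)%E.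
by rewrite poweR_EFin -(real_normK (num_real c)) -powR_mulrn// -powRrM divff// powRr1.
Qed.

Lemma L2_scale c h : h \in L2 -> (fun x => c * h x) \in L2.
Proof.
move=> hL; apply: L2P; first by apply: measurable_funM => //; exact: L2_measurable.
by rewrite L2normZ// lte_mul_pinfty ?lee_fin// L2norm_lty.
Qed.

Lemma L2norm_eq0 h : h \in L2 -> N h = 0%E -> h = cst 0 %[ae nu].
Proof.
move=> hL Nh; have mh : measurable_fun setT (EFin \o h).
  by apply/measurable_EFinP; exact: L2_measurable.
have two0 : (0 < 2%:E :> \bar R)%E by rewrite lte_fin.
have := Lnorm_eq0_eq0 mh two0 Nh.
by apply: filterS => x /= /(_ I) [->].
Qed.

End L2_seminorm.

#[global] Hint Extern 0 (is_true (0%R <= L2norm _ _)%E) =>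
  solve [apply: L2norm_ge0] : core.

(** * Completeness of L^2 *)

Section L2_complete.
Context {R : realType} {d} {X : measurableType d}.
Variable nu : {measure set X -> \bar R}.
Local Notation L2 := (Lfun nu 2%:E).
Local Notation N := (L2norm nu).

(** The partial sums of the |g k.+1 - g k| are bounded in norm; by monotone
    convergence their limit has a finite norm, hence is finite almost
    everywhere. *)
Lemma ae_cvg_geometric (g : nat -> X -> R) : (forall k, g k \in L2) ->
  (forall k, (N (g k.+1 \- g k) <= (2^-1 ^+ k)%:E)%E) ->
  {ae nu, forall x, cvgn (g ^~ x)}.
Proof.
move=> gL gk.
pose G (m : nat) (x : X) : R := \sum_(0 <= k < m) `|g k.+1 x - g k x|.
have GL m : G m \in L2 /\ (N (G m) <= (2 - 2 * 2^-1 ^+ m)%:E)%E.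
  elim: m => [|m [ihL ih]].
    have -> : G 0%N = cst 0 by apply/funext => x; rewrite /G big_nil.
    by rewrite L2_cst0 L2norm_cst0 lee_fin expr0 mulr1 subrr.
  have dL : (fun x => `|g m.+1 x - g m x|) \in L2.
    apply: L2P; last first.
      apply: le_lt_trans (L2norm_lty (L2_sub (gL m.+1) (gL m))).
      apply: le_L2norm => [| |x]; last by rewrite normr_id.
        by apply: measurableT_comp => //; exact/L2_measurable/L2_sub.
      exact/L2_measurable/L2_sub.
    by apply: measurableT_comp => //; exact/L2_measurable/L2_sub.
  have -> : G m.+1 = G m \+ (fun x => `|g m.+1 x - g m x|).
    by apply/funext => x; rewrite /G big_nat_recr.
  split; first exact: L2_add.
  apply: le_trans (L2normD ihL dL) _.
  have -> : 2 - 2 * 2^-1 ^+ m.+1 = 2 - 2 * 2^-1 ^+ m + 2^-1 ^+ m :> R.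
    by rewrite exprS; lra.
  rewrite EFinD; apply: leeD => //.
  apply: le_trans (gk m); apply: le_L2norm => [| |x]; last by rewrite normr_id.
    by apply: measurableT_comp => //; exact/L2_measurable/L2_sub.
  exact/L2_measurable/L2_sub.
have mG m : measurable_fun setT (G m) by have [/L2_measurable] := GL m.
have G0 m x : 0 <= G m x by apply: sumr_ge0.
have Gnd x : {homo G ^~ x : m n / (m <= n)%N >-> m <= n}.
  by apply/nondecreasing_seqP => m; rewrite /G big_nat_recr//= lerDl.
pose S x := limn (fun m => (G m x ^+ 2)%:E).
have S_lty : (\int[nu]_x S x < +oo)%E.
  rewrite /S monotone_convergence//; last 3 first.
  - by move=> m; exact: measurable_sqr.
  - by move=> m x _; rewrite lee_fin sqr_ge0.
  - by move=> x _ m n mn; rewrite lee_fin ler_sqr ?nnegrE//; exact: Gnd.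
  apply: (@le_lt_trans _ _ 4%:E); last exact: ltry.
  apply: lime_le.
    apply: ereal_nondecreasing_is_cvgn => m n mn; apply: ge0_le_integral => //.
    - by move=> x _; rewrite lee_fin sqr_ge0.
    - exact: measurable_sqr.
    - exact: measurable_sqr.
    - by move=> x _; rewrite lee_fin ler_sqr ?nnegrE//; exact: Gnd.
  apply: nearW => m; have [_ Gm] := GL m.
  have : (N (G m) <= 2%:E)%E.
    by apply: le_trans Gm _; rewrite lee_fin lerBlDr lerDl mulr_ge0// exprn_ge0.
  by move/L2norm_leP => /(_ (ler0n _ _)); rewrite -natrX.
have mS : measurable_fun setT S.
  apply: (emeasurable_fun_cvg (fun m x => (G m x ^+ 2)%:E)).
    by move=> m; exact: measurable_sqr.
  move=> x _; apply: ereal_nondecreasing_is_cvgn => m n mn.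
  by rewrite lee_fin ler_sqr ?nnegrE//; exact: Gnd.
have S0 x : (0 <= S x)%E.
  apply: lime_ge; first apply: ereal_nondecreasing_is_cvgn => m n mn.
    by rewrite lee_fin ler_sqr ?nnegrE//; exact: Gnd.
  by apply: nearW => m; rewrite lee_fin sqr_ge0.
have iS : nu.-integrable setT S.
  by apply/integrableP; split => //; under eq_integral do rewrite gee0_abs//.
have := integrable_ae measurableT iS.
apply: filterS => x /(_ I) Sx.
have Gub m : G m x <= fine (S x) + 1.
  have : (G m x) ^+ 2 <= fine (S x).
    rewrite -lee_fin fineK//; apply: lime_ge.
      apply: ereal_nondecreasing_is_cvgn => p n pn.
      by rewrite lee_fin ler_sqr ?nnegrE//; exact: Gnd.
    by near=> n; rewrite lee_fin ler_sqr ?nnegrE//; apply: Gnd; near: n; exact: nbhs_infty_ge.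
  have := G0 m x; nra.
have : cvgn [normed series (fun k => g k.+1 x - g k x)].
  rewrite (_ : [normed series _] = G ^~ x)//.
  apply: nondecreasing_is_cvgn; first exact: Gnd.
  by exists (fine (S x) + 1) => _ [m _ <-].
move/normed_cvg => cv.
rewrite (_ : g ^~ x = (fun m => g 0%N x + series (fun k => g k.+1 x - g k x) m)).
  by apply: is_cvgD => //; exact: is_cvg_cst.
by apply/funext => m; rewrite /series/= telescope_sumr// addrC subrK.
Unshelve. all: by end_near. Qed.

(** The Riesz-Fischer theorem. The limit is the pointwise limit of a subsequence
    that converges almost everywhere; Fatou's lemma gives convergence in
    norm. *)
Lemma L2_complete (h : nat -> X -> R) : (forall n, h n \in L2) ->
  (forall e : R, 0 < e -> exists n0 : nat, forall m n, (n0 <= m)%N -> (n0 <= n)%N ->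
    (N (h m \- h n) <= e%:E)%E) ->
  exists2 l, l \in L2 & N (h n \- l) @[n --> \oo] --> 0%E.
Proof.
move=> hL hC.
have e0 k : 0 < 2^-1 ^+ k :> R by rewrite exprn_gt0.
have [r rP] := choice (fun k => hC _ (e0 k)).
pose q := fix q (k : nat) : nat :=
  if k is j.+1 then maxn (q j) (r k) else r 0%N.
have rq k : (r k <= q k)%N by case: k => //= k; rewrite leq_maxr.
have q1 k : (q k <= q k.+1)%N by rewrite /= leq_maxl.
pose g k := h (q k).
have gL k : g k \in L2 by exact: hL.
have gN k n : (r k <= n)%N -> (N (g k \- h n) <= (2^-1 ^+ k)%:E)%E.
  by move=> kn; exact: rP.
have gcvg : {ae nu, forall x, cvgn (g ^~ x)}.
  apply: ae_cvg_geometric => // k; rewrite L2normB; apply: gN.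
  by rewrite (leq_trans (rq k)).
(* a limit superior rather than a limit, so that l is measurable on all of X *)
pose l x := fine (limn_esup (fun k => (g k x)%:E)).
have lE x : cvgn (g ^~ x) -> g k x @[k --> \oo] --> l x.
  move=> /cvg_ex[/= y gy]; rewrite /l.
  have gy' : (fun k => (g k x)%:E) @ \oo --> y%:E by exact: cvg_EFin_comp.
  by rewrite (cvg_limn_einf_sup gy')/=.
have ml : measurable_fun setT l.
  apply: measurableT_comp => //; apply: measurable_fun_limn_esup => k.
  by apply/measurable_EFinP; exact: L2_measurable.
have gl n k : (r k <= n)%N -> (N (h n \- l) <= (2^-1 ^+ k)%:E)%E.
  move=> kn; apply/L2norm_leP; first exact: ltW.
  have mhg m : measurable_fun setT (h n \- g m).
    by apply: L2_measurable; exact: L2_sub.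
  apply: (@le_trans _ _
    (\int[nu]_x limn_einf (fun m => ((h n x - g m x) ^+ 2)%:E))%E).
    apply: ae_ge0_le_integral => //.
    - by move=> x _; rewrite lee_fin sqr_ge0.
    - by apply: measurable_sqr; apply: measurable_funB => //; exact: L2_measurable.
    - move=> x _; rewrite limn_einf_lim; apply: lime_ge; first exact: is_cvg_einfs.
      apply: nearW => m; apply: le_ereal_inf_tmp => _ [j _ <-].
      by rewrite lee_fin sqr_ge0.
    - apply: (emeasurable_fun_cvg
        (fun i x => einfs (fun m => ((h n x - g m x) ^+ 2)%:E) i)) => [m|x _].
        by apply: measurable_fun_einfs => j; exact: (measurable_sqr (mhg j)).
      by rewrite limn_einf_lim; exact: is_cvg_einfs.
    - apply: filterS gcvg => x /lE gx _.
      have cv : (fun m => ((h n x - g m x) ^+ 2)%:E) @ \oo --> ((h n x - l x) ^+ 2)%:E.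
        apply: cvg_EFin_comp.
        by apply: cvgM; apply: cvgB => //; exact: cvg_cst.
      by rewrite (cvg_limn_einf_sup cv).
  apply: (le_trans (fatou _ _ _ _)) => //.
  - by move=> m; exact: (measurable_sqr (mhg m)).
  - by move=> m x _; rewrite lee_fin sqr_ge0.
  rewrite limn_einf_lim; apply: lime_le.
    exact: is_cvg_einfs.
  near=> m; apply: le_trans (_ : (\int[nu]_x ((h n x - g m x) ^+ 2)%:E <= _)%E).
    by apply: ereal_inf_lbound; exists m => //=.
  apply/(L2norm_leP nu (h n \- g m)); first exact: ltW.
  rewrite L2normB; apply: rP => //; rewrite (leq_trans (rq k))//.
  have qm : {homo q : a b / (a <= b)%N}.
    by apply: homo_leq => // a b c; exact: leq_trans.
  by apply: qm; near: m; exact: nbhs_infty_ge.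
have lL : l \in L2.
  have -> : l = h (r 0%N) \- (h (r 0%N) \- l).
    by apply/funext => x /=; rewrite opprB addrC subrK.
  apply: L2_sub => //; apply: L2P.
    by apply: measurable_funB => //; exact: L2_measurable.
  by apply: le_lt_trans (gl _ 0%N _) _ => //; exact: ltry.
exists l => //.
apply/cvge0P; first by move=> n; exact: L2norm_ge0.
move=> e e_gt0.
have /cvgrPdist_le/(_ _ e_gt0)[k _ /(_ k (leqnn k))/= ke] :
  geometric 1 2^-1 @ \oo --> (0 : R).
  by apply: cvg_geometric; rewrite ger0_norm//; lra.
near=> n; apply: (@le_trans _ _ (2^-1 ^+ k)%:E).
  by apply: gl; near: n; exact: nbhs_infty_ge.
by move: ke; rewrite sub0r normrN mul1r ger0_norm// exprn_ge0.
Unshelve. all: by end_near. Qed.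

End L2_complete.

(** * Curves with finitely many values *)

Section L2_sums.
Context {R : realType} {d} {X : measurableType d}.
Variable nu : {measure set X -> \bar R}.
Local Notation L2 := (Lfun nu 2%:E).
Local Notation N := (L2norm nu).

Lemma L2_sum (I : finType) (m : I -> R) (g : I -> X -> R) :
  (forall i, g i \in L2) ->
  (fun x => \sum_i m i * g i x) \in L2 /\
  (N (fun x => \sum_i m i * g i x)%R <= \sum_i `|m i|%:E * N (g i))%E.
Proof.
move=> gL.
suff : forall r : seq I, (fun x => \sum_(i <- r) m i * g i x) \in L2 /\
  (N (fun x => \sum_(i <- r) m i * g i x)%R <= \sum_(i <- r) `|m i|%:E * N (g i))%E.
  by apply.
elim => [|i r [ihL ih]].
  have -> : (fun x => \sum_(i <- [::]) m i * g i x) = cst 0.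
    by apply/funext => x; rewrite big_nil.
  by rewrite big_nil L2_cst0 L2norm_cst0.
have -> : (fun x => \sum_(j <- i :: r) m j * g j x) =
    (fun x => m i * g i x) \+ (fun x => \sum_(j <- r) m j * g j x).
  by apply/funext => x; rewrite big_cons.
have miL : (fun x => m i * g i x) \in L2 by exact: L2_scale.
split; first exact: L2_add.
by rewrite big_cons (le_trans (L2normD miL ihL))// leeD// L2normZ.
Qed.

End L2_sums.

Section step_curves.
Context {R : realType}.
Local Notation leb := (@lebesgue_measure R).

Section finite_valued.
Variables (I : finType) (c : R -> I).
Hypothesis mc : forall i, measurable (c @^-1` [set i]).

Lemma measurable_finite_comp d' (U : measurableType d') (D : set R) (phi : I -> U) :
  measurable D -> measurable_fun D (phi \o c).
Proof.
move=> mD _ B mB; apply: measurableI => //.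
have -> : (phi \o c) @^-1` B =
    \big[setU/set0]_(i <- enum I | `[< B (phi i) >]) (c @^-1` [set i]).
  rewrite -bigcup_seq_cond; apply/seteqP; split => [t Bt|t [i /= /andP[_ /asboolP Bi] /= ->//]].
  by exists (c t) => //=; rewrite mem_enum/=; exact/asboolP.
exact: bigsetU_measurable.
Qed.

Lemma integrable_finite_comp (D : set R) (phi : I -> R) : measurable D ->
  (leb D < +oo)%E -> leb.-integrable D (EFin \o (fun t => phi (c t))).
Proof.
move=> mD Doo; apply: measurable_bounded_integrable => //.
  exact: (measurable_finite_comp phi mD).
exists (\sum_i `|phi i|); split; first exact: num_real.
move=> M /ltW sM t _ /=; apply: le_trans sM.
by rewrite (bigD1 (c t))//= lerDl sumr_ge0.
Qed.

Lemma integral_finite_comp (D : set R) (phi : I -> R) : measurable D ->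
  (leb D < +oo)%E ->
  (\int[leb]_(t in D) (phi (c t))%:E =
   (\sum_i fine (leb (c @^-1` [set i] `&` D)) * phi i)%R%:E)%E.
Proof.
move=> mD Doo.
have mcD i : measurable (c @^-1` [set i] `&` D) by exact: measurableI.
have fin i : leb (c @^-1` [set i] `&` D) \is a fin_num.
  rewrite ge0_fin_numE//; apply: le_lt_trans Doo.
  by apply: le_measure; rewrite ?inE//; exact: mcD.
transitivity (\int[leb]_(t in D)
    \sum_(i <- enum I) ((phi i)%:E * (\1_(c @^-1` [set i]) t)%:E))%E.
  apply: eq_integral => t _; rewrite (bigD1_seq (c t)) ?mem_enum ?enum_uniq//=.
  rewrite indicE mem_set// mule1 big1 ?adde0// => i ict.
  by rewrite indicE memNset ?mule0// => /= cti; rewrite cti eqxx in ict.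
have ii i : leb.-integrable D (fun t => (\1_(c @^-1` [set i]) t)%:E).
  apply/integrableP; split; first by apply/measurable_EFinP; exact: (measurable_indic (mc i)).
  under eq_integral do rewrite gee0_abs ?lee_fin//.
  rewrite (integral_indic leb mD (mc i)).
  by have := fin i; rewrite ge0_fin_numE.
rewrite integral_sum//; last by move=> i; exact: integrableZl.
rewrite -sumEFin big_enum/=; apply: eq_bigr => i _.
rewrite integralZl//; rewrite (integral_indic leb mD (mc i)).
by rewrite muleC EFinM fineK.
Qed.

End finite_valued.

Context {d} {X : measurableType d}.
Variable nu : {measure set X -> \bar R}.
Local Notation L2 := (Lfun nu 2%:E).
Local Notation N := (L2norm nu).
Implicit Types (u : R -> X -> R) (D : set R).

(** Curves with finitely many values, factored as g o c, where c takes its values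
    in a finite type and has measurable fibres. Contrary to the sets in a simple
    curve, these fibres may have infinite measure, but they are disjoint. *)
Definition step_curve u := exists (I : finType) (c : R -> I) (g : I -> X -> R),
  [/\ forall i, measurable (c @^-1` [set i]), forall i, g i \in L2 &
      u = (fun t => g (c t))].

Lemma step_curve_L2 u t : step_curve u -> u t \in L2.
Proof. by move=> [I [c [g [_ gL ->]]]]. Qed.

(** The value of a simple curve at t is determined by which of its sets
    contain t. *)
Lemma simple_step u : simple_curve nu u -> step_curve u.
Proof.
move=> [n [A [h [mA hL ->]]]].
exists {ffun 'I_n -> bool}, (fun t => [ffun i => t \in A i]),
  (fun (S : {ffun 'I_n -> bool}) x => \sum_(i < n) (S i)%:R * h i x); split.
- move=> S.
  have -> : (fun t => [ffun i => t \in A i]) @^-1` [set S] =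
      \big[setI/setT]_(i <- enum 'I_n) (if S i then A i else ~` A i).
    rewrite -bigcap_seq; apply/seteqP; split => [t /= <- i _|t /= tS].
      by rewrite ffunE; case: ifPn => [/set_mem//|/negP tA At]; apply: tA; exact: mem_set.
    have ie i : i \in enum 'I_n by rewrite mem_enum.
    apply/ffunP => i; rewrite ffunE; have := tS i (ie i).
    by case: (S i) => At; [rewrite mem_set|rewrite memNset].
  apply: bigsetI_measurable => i _; have [mAi _] := mA i.
  by case: ifPn => _ //; exact: measurableC.
- by move=> S; have [] := L2_sum (fun i => (S i)%:R) hL.
- apply/funext => t; apply/funext => x; apply: eq_bigr => i _.
  by rewrite ffunE indicE.
Qed.

Lemma step_simple u D : measurable D -> (leb D < +oo)%E -> step_curve u ->
  exists s, simple_curve nu s /\ forall t, s t = if t \in D then u t else cst 0.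
Proof.
move=> mD Doo [I [c [g [mc gL ->]]]].
exists (fun t x => \sum_(i < #|I|) \1_(c @^-1` [set enum_val i] `&` D) t * g (enum_val i) x).
split.
  exists #|I|, (fun i => c @^-1` [set enum_val i] `&` D), (fun i => g (enum_val i)).
  have mcD i : measurable (c @^-1` [set i] `&` D) by exact: measurableI.
  split => // i; split; first exact: mcD.
  by apply: le_lt_trans Doo; apply: le_measure; rewrite ?inE//; exact: mcD.
move=> t; apply/funext => x; case: ifPn => [tD|tD]; last first.
  by rewrite big1// => i _; rewrite indicE in_setI (negbTE tD) andbF mul0r.
rewrite (bigD1 (enum_rank (c t)))//= enum_rankK indicE in_setI tD andbT.
rewrite mem_set// mul1r big1 ?addr0// => i ict.
rewrite indicE in_setI memNset ?mul0r//= => cti.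
by rewrite cti enum_valK eqxx in ict.
Qed.

Lemma measurable_step u D (phi : (X -> R) -> \bar R) : measurable D ->
  step_curve u -> measurable_fun D (fun t => phi (u t)).
Proof.
move=> mD [I [c [g [mc gL ->]]]].
exact: (measurable_finite_comp mc (phi \o g)).
Qed.

Lemma step_integral u D : measurable D -> (leb D < +oo)%E -> step_curve u ->
  (fun x => \int[leb]_(t in D) u t x) \in L2 /\
  (N (fun x => \int[leb]_(t in D) u t x)%R <= L1L2norm nu D u)%E.
Proof.
move=> mD Doo [I [c [g [mc gL ->]]]].
pose m i := fine (leb (c @^-1` [set i] `&` D)).
have -> : (fun x => \int[leb]_(t in D) g (c t) x) = (fun x => \sum_i m i * g i x).
  apply/funext => x; rewrite /Rintegral.
  by rewrite (integral_finite_comp mc (fun i => g i x)).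
have [sL sN] := L2_sum m gL; split => //; apply: le_trans sN _.
rewrite /L1L2norm (_ : (fun t => _) = fun t => (fine (N (g (c t))))%:E); last first.
  by apply/funext => t; rewrite L2norm_fineK.
rewrite (integral_finite_comp mc (fun i => fine (N (g i))))// -sumEFin.
apply: lee_sum => i _; rewrite EFinM L2norm_fineK// ger0_norm//.
by rewrite fine_ge0.
Qed.

Lemma step_integralB u v D x : measurable D -> (leb D < +oo)%E ->
  step_curve u -> step_curve v ->
  \int[leb]_(t in D) (u t \- v t) x =
  \int[leb]_(t in D) u t x - \int[leb]_(t in D) v t x.
Proof.
move=> mD Doo [I [c [g [mc gL ->]]]] [J [e [f [me fL ->]]]].
rewrite RintegralB//.
  exact: (integrable_finite_comp mc (g ^~ x) mD Doo).
exact: (integrable_finite_comp me (f ^~ x) mD Doo).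
Qed.

End step_curves.

Section step_comp2.
Context {R : realType} {d1 d2 d3} {X1 : measurableType d1}
  {X2 : measurableType d2} {X3 : measurableType d3}.
Variables (nu1 : {measure set X1 -> \bar R}) (nu2 : {measure set X2 -> \bar R})
  (nu3 : {measure set X3 -> \bar R}).
Local Notation leb := (@lebesgue_measure R).

Lemma step_comp2 (F : (X1 -> R) -> (X2 -> R) -> X3 -> R) u1 u2 :
  (forall h k, h \in Lfun nu1 2%:E -> k \in Lfun nu2 2%:E -> F h k \in Lfun nu3 2%:E) ->
  step_curve nu1 u1 -> step_curve nu2 u2 ->
  step_curve nu3 (fun t => F (u1 t) (u2 t)).
Proof.
move=> FL [I [c [g [mc gL ->]]]] [J [e [f [me fL ->]]]].
exists (I * J)%type, (fun t => (c t, e t)), (fun ij => F (g ij.1) (f ij.2)).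
split=> [[i j]|[i j]|//]; last exact: FL.
have -> : (fun t => (c t, e t)) @^-1` [set (i, j)] = c @^-1` [set i] `&` e @^-1` [set j].
  by apply/seteqP; split => [t [] <- <-|t [/= -> ->]].
exact: measurableI.
Qed.

End step_comp2.

(** * Strongly measurable curves *)

Section strongly_measurable_theory.
Context {R : realType} {d} {X : measurableType d}.
Variable nu : {measure set X -> \bar R}.
Local Notation leb := (@lebesgue_measure R).
Local Notation L2 := (Lfun nu 2%:E).
Local Notation N := (L2norm nu).
Implicit Types (u v : R -> X -> R).

Lemma cvg_L2norm (h : X -> R) (hs : nat -> X -> R) :
  h \in L2 -> (forall n, hs n \in L2) ->
  N (h \- hs n) @[n --> \oo] --> 0%E -> N (hs n) @[n --> \oo] --> N h.
Proof.
move=> hL hsL hs0.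
apply: (@squeeze_cvge _ _ _ _ (fun n => N h - N (h \- hs n))%E _
                              (fun n => N h + N (h \- hs n))%E).
- apply: nearW => n; rewrite leeBlDr ?L2norm_fin_num ?L2_sub//.
  rewrite addeC L2norm_le_sub//= L2normB.
  by rewrite addeC L2norm_le_sub.
- rewrite -[X in _ --> X]sube0; apply: cvgeB => //; last exact: cvg_cst.
  by rewrite fin_num_adde_defl.
- rewrite -[X in _ --> X]adde0; apply: cvgeD => //; last exact: cvg_cst.
  by rewrite fin_num_adde_defl.
Qed.

Section domain.
Variable D : set R.
Hypotheses (mD : measurable D) (Doo : (leb D < +oo)%E).

Lemma strongly_measurable_stepP u : strongly_measurable nu D u <->
  (forall t, D t -> u t \in L2) /\
  exists s : nat -> R -> X -> R, (forall k, step_curve nu (s k)) /\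
    (forall t, D t -> N (u t \- s k t) @[k --> \oo] --> 0%E).
Proof.
split=> -[uL [s [sS us]]]; split => //.
  by exists s; split => // k; exact: simple_step.
have [s' s'P] := choice (fun k => step_simple mD Doo (sS k)).
exists s'; split => [k|t Dt]; first by have [] := s'P k.
rewrite (_ : (fun k => _) = (fun k => N (u t \- s k t))); first exact: us.
by apply/funext => k; rewrite (s'P _).2 mem_set.
Qed.

Lemma strongly_measurable_L2 u t : strongly_measurable nu D u -> D t -> u t \in L2.
Proof. by move=> [+ _]; apply. Qed.

Lemma step_strongly_measurable u : step_curve nu u -> strongly_measurable nu D u.
Proof.
move=> uS; apply/strongly_measurable_stepP; split.
  by move=> t _; exact: step_curve_L2 uS.
exists (fun=> u); split => // t Dt; rewrite (_ : (fun=> _) = cst 0%E).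
  exact: cvg_cst.
by apply/funext => k; rewrite fun_subrr L2norm_cst0.
Qed.

Lemma measurable_L2norm_curve u : strongly_measurable nu D u ->
  measurable_fun D (fun t => N (u t)).
Proof.
move=> /strongly_measurable_stepP[uL [s [sS us]]].
apply: (emeasurable_fun_cvg (fun k t => N (s k t))).
  by move=> k; exact: (measurable_step N).
move=> t Dt; apply: cvg_L2norm; [exact: uL| |exact: us].
by move=> k; exact: step_curve_L2.
Qed.

Lemma L1L2norm_ge0 u : (0 <= L1L2norm nu D u)%E.
Proof. by apply: integral_ge0 => t _; exact: L2norm_ge0. Qed.

Lemma le_L1L2norm u (f : R -> \bar R) : strongly_measurable nu D u ->
  measurable_fun D f -> (forall t, D t -> (N (u t) <= f t)%E) ->
  (L1L2norm nu D u <= \int[leb]_(t in D) f t)%E.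
Proof.
move=> um fm uf; apply: ge0_le_integral => //.
  exact: (measurable_L2norm_curve um).
Qed.

Lemma le_L1L2normD u v w : strongly_measurable nu D u ->
  strongly_measurable nu D v -> strongly_measurable nu D w ->
  (forall t, D t -> (N (u t) <= N (v t) + N (w t))%E) ->
  (L1L2norm nu D u <= L1L2norm nu D v + L1L2norm nu D w)%E.
Proof.
move=> um vm wm uvw.
have mv := measurable_L2norm_curve vm; have mw := measurable_L2norm_curve wm.
apply: le_trans (le_L1L2norm um (emeasurable_funD mv mw) uvw) _.
rewrite ge0_integralD//.
Qed.

End domain.
End strongly_measurable_theory.

Section strongly_measurable_comp.
Context {R : realType} {d1 d2 d3} {X1 : measurableType d1}
  {X2 : measurableType d2} {X3 : measurableType d3}.
Variables (nu1 : {measure set X1 -> \bar R}) (nu2 : {measure set X2 -> \bar R})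
  (nu3 : {measure set X3 -> \bar R}).
Local Notation leb := (@lebesgue_measure R).

(** A map between L^2 spaces that is sequentially continuous preserves strong
    measurability. *)
Lemma strongly_measurable_comp2 (D : set R) (F : (X1 -> R) -> (X2 -> R) -> X3 -> R) u1 u2 :
  measurable D -> (leb D < +oo)%E ->
  (forall h k, h \in Lfun nu1 2%:E -> k \in Lfun nu2 2%:E -> F h k \in Lfun nu3 2%:E) ->
  (forall h k hs ks, h \in Lfun nu1 2%:E -> k \in Lfun nu2 2%:E ->
    (forall n : nat, hs n \in Lfun nu1 2%:E) ->
    (forall n : nat, ks n \in Lfun nu2 2%:E) ->
    L2norm nu1 (h \- hs n) @[n --> \oo] --> 0%E ->
    L2norm nu2 (k \- ks n) @[n --> \oo] --> 0%E ->
    L2norm nu3 (F h k \- F (hs n) (ks n)) @[n --> \oo] --> 0%E) ->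
  strongly_measurable nu1 D u1 -> strongly_measurable nu2 D u2 ->
  strongly_measurable nu3 D (fun t => F (u1 t) (u2 t)).
Proof.
move=> mD Doo FL Fcvg /(strongly_measurable_stepP _ mD Doo)[u1L [s1 [s1S us1]]].
move=> /(strongly_measurable_stepP _ mD Doo)[u2L [s2 [s2S us2]]].
apply/(strongly_measurable_stepP _ mD Doo); split.
  by move=> t Dt; apply: FL; [exact: u1L|exact: u2L].
exists (fun k t => F (s1 k t) (s2 k t)); split.
  by move=> k; exact: step_comp2 FL (s1S k) (s2S k).
move=> t Dt; apply: Fcvg; [exact: u1L|exact: u2L| | |exact: us1|exact: us2].
- by move=> n; exact: step_curve_L2.
- by move=> n; exact: step_curve_L2.
Qed.

End strongly_measurable_comp.

(** * The Bochner integral *)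

Section Bochner_theory.
Context {R : realType} {d} {X : measurableType d}.
Variable nu : {measure set X -> \bar R}.
Local Notation leb := (@lebesgue_measure R).
Local Notation L2 := (Lfun nu 2%:E).
Local Notation N := (L2norm nu).
Implicit Types (u : R -> X -> R) (v : X -> R).

Section domain.
Variable D : set R.
Hypotheses (mD : measurable D) (Doo : (leb D < +oo)%E).

Lemma strongly_measurable_sub u1 u2 : strongly_measurable nu D u1 ->
  strongly_measurable nu D u2 -> strongly_measurable nu D (fun t => u1 t \- u2 t).
Proof.
apply: (strongly_measurable_comp2 (F := fun h k => h \- k)) => //.
  by move=> h k; exact: L2_sub.
move=> h k hs ks hL kL hsL ksL hhs kks.
apply: cvge0_le (cvge0D hhs kks); first by move=> n; exact: L2norm_ge0.
apply: nearW => n.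
have -> : (h \- k) \- (hs n \- ks n) = (h \- hs n) \- (k \- ks n).
  by apply/funext => x /=; ring.
by apply: L2norm_subD; exact: L2_sub.
Qed.

Lemma is_Bochner_stepP u v : is_Bochner_integral nu D u v <->
  [/\ strongly_measurable nu D u, v \in L2 &
  exists s : nat -> R -> X -> R, [/\ forall k, step_curve nu (s k),
    L1L2norm nu D (fun t => u t \- s k t) @[k --> \oo] --> 0%E &
    N ((fun x => \int[leb]_(t in D) s k t x) \- v) @[k --> \oo] --> 0%E]].
Proof.
split=> -[um vL [s [sS us sv]]]; split => //.
  by exists s; split => // k; exact: simple_step.
have [s' s'P] := choice (fun k => step_simple mD Doo (sS k)).
exists s'; split => [k||]; first by have [] := s'P k.
- rewrite (_ : (fun k => _) = (fun k => L1L2norm nu D (fun t => u t \- s k t)))//.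
  apply/funext => k; apply: eq_integral => t tD.
  by rewrite (s'P _).2 tD.
- rewrite (_ : (fun k => _) = (fun k => N ((fun x => \int[leb]_(t in D) s k t x) \- v)))//.
  apply/funext => k; congr (N (_ \- _)); apply/funext => x.
  by apply: eq_Rintegral => t tD; rewrite (s'P _).2 tD.
Qed.

Lemma L2norm_Bochner u v : is_Bochner_integral nu D u v ->
  (N v <= L1L2norm nu D u)%E.
Proof.
move=> /is_Bochner_stepP[um vL [s [sS us sv]]].
have ssm k := step_strongly_measurable mD Doo (sS k).
pose e k := (N ((fun x => \int[leb]_(t in D) s k t x)%R \- v) +
  L1L2norm nu D (fun t => u t \- s k t)%R)%E.
have e0 : e k @[k --> \oo] --> 0%E by exact: cvge0D.
have Ve : L1L2norm nu D u + e k @[k --> \oo] --> L1L2norm nu D u.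
  have [->|ufin] := eqVneq (L1L2norm nu D u) +oo%E.
    rewrite (_ : (fun k => _) = cst +oo%E); first exact: cvg_cst.
    apply/funext => k; rewrite addye// gt_eqF// (lt_le_trans ltNy0)//.
    by rewrite adde_ge0// ?L2norm_ge0// L1L2norm_ge0.
  rewrite -[X in _ --> X]adde0; apply: cvgeD => //; last exact: cvg_cst.
  by rewrite fin_num_adde_defl.
apply: (cvge_to_ge Ve); apply: nearW => k.
have [VL VN] := step_integral mD Doo (sS k).
apply: le_trans (L2norm_le_sub vL VL) _.
rewrite L2normB /e addeCA leeD2l//.
apply: (le_trans VN); apply: le_L1L2normD => //.
  exact: strongly_measurable_sub.
move=> t Dt; rewrite L2normB addeC; apply: L2norm_le_sub.
  exact: step_curve_L2.
exact: strongly_measurable_L2 um Dt.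
Qed.

Lemma Bochner_sub u1 u2 v1 v2 : is_Bochner_integral nu D u1 v1 ->
  is_Bochner_integral nu D u2 v2 ->
  is_Bochner_integral nu D (fun t => u1 t \- u2 t) (v1 \- v2).
Proof.
move=> /is_Bochner_stepP[u1m v1L [s1 [s1S us1 sv1]]].
move=> /is_Bochner_stepP[u2m v2L [s2 [s2S us2 sv2]]].
have sS k : step_curve nu (fun t => s1 k t \- s2 k t).
  by apply: (step_comp2 (F := fun h g => h \- g)) => // h g; exact: L2_sub.
have s1m k := step_strongly_measurable mD Doo (s1S k).
have s2m k := step_strongly_measurable mD Doo (s2S k).
have sm k := step_strongly_measurable mD Doo (sS k).
apply/is_Bochner_stepP; split.
- exact: strongly_measurable_sub.
- exact: L2_sub.
exists (fun k t => s1 k t \- s2 k t); split => //.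
- apply: cvge0_le (cvge0D us1 us2); first by move=> k; exact: L1L2norm_ge0.
  apply: nearW => k; apply: le_L1L2normD => //; try exact: strongly_measurable_sub.
    by apply: strongly_measurable_sub => //; exact: strongly_measurable_sub.
  move=> t Dt.
  have -> : (u1 t \- u2 t) \- (s1 k t \- s2 k t) = (u1 t \- s1 k t) \- (u2 t \- s2 k t).
    by apply/funext => x /=; ring.
  apply: L2norm_subD; apply: L2_sub.
  - exact: strongly_measurable_L2 u1m Dt.
  - exact: step_curve_L2 (s1S k).
  - exact: strongly_measurable_L2 u2m Dt.
  - exact: step_curve_L2 (s2S k).
- apply: cvge0_le (cvge0D sv1 sv2); first by move=> k; exact: L2norm_ge0.
  apply: nearW => k.
  have [V1L _] := step_integral mD Doo (s1S k).
  have [V2L _] := step_integral mD Doo (s2S k).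
  rewrite (_ : _ \- _ = ((fun x => \int[leb]_(t in D) s1 k t x) \- v1) \-
      ((fun x => \int[leb]_(t in D) s2 k t x) \- v2)).
    by apply: L2norm_subD; exact: L2_sub.
  apply/funext => x /=; rewrite (step_integralB x mD Doo (s1S k) (s2S k)); ring.
Qed.

Lemma ae_eq_Bochner u v v' : is_Bochner_integral nu D u v -> v' \in L2 ->
  N (v \- v') = 0%E -> is_Bochner_integral nu D u v'.
Proof.
move=> [um vL [s [sS us sv]]] v'L vv'; split => //; exists s; split => //.
have VL k : (fun x => \int[leb]_(t in D) s k t x) \in L2.
  by have [] := step_integral mD Doo (simple_step (sS k)).
apply: (cvge0_le _ _ sv); first by move=> k.
apply: nearW => k.
have := L2norm_subsub (VL k) v'L vL.
by rewrite vv' adde0.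
Qed.

Lemma step_if u E : measurable E -> step_curve nu u ->
  step_curve nu (fun t => if t \in E then u t else cst 0).
Proof.
move=> mE [I [c [g [mc gL ->]]]].
exists (I * bool)%type, (fun t => (c t, t \in E)),
  (fun ib => if ib.2 then g ib.1 else cst 0); split => // [[i b]|[i []]/=]; last first.
- exact: L2_cst0.
- exact: gL.
have -> : (fun t => (c t, t \in E)) @^-1` [set (i, b)] =
    c @^-1` [set i] `&` (if b then E else ~` E).
  apply/seteqP; split => [t [] <- <-|t [/= ->]].
    by split => //; case: ifPn => [/set_mem//|/negP tE Et]; apply: tE; exact: mem_set.
  by case: b => tE; [rewrite mem_set|rewrite memNset].
by apply: measurableI => //; case: b => //; exact: measurableC.
Qed.

(** A strongly measurable curve whose norm is integrable has a Bochner integral: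
    the approximating step curves are cut off where their norm exceeds twice
    that of the curve, so that dominated convergence applies, and their
    integrals form a Cauchy sequence. *)
Lemma Bochner_exists u : in_L1L2 nu D u ->
  exists v, is_Bochner_integral nu D u v.
Proof.
move=> [um uoo].
have [uL [s [sS us]]] := (strongly_measurable_stepP _ mD Doo u).1 um.
have mNu := measurable_L2norm_curve mD Doo um.
pose E k := D `&` [set t | (N (s k t) <= 2%:E * N (u t))%E].
have mE k : measurable (E k).
  apply: measurable_lee => //; first exact: (measurable_step N mD (sS k)).
  exact: measurable_funeM.
pose s' k t : X -> R := if t \in E k then s k t else cst 0.
have s'S k : step_curve nu (s' k) by exact: step_if.
have s'm k := step_strongly_measurable mD Doo (s'S k).
have us'm k := strongly_measurable_sub um (s'm k).
have s'2 k t : D t -> (N (s' k t) <= 2%:E * N (u t))%E.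
  move=> Dt; rewrite /s'; case: ifPn => [/set_mem[]//|_].
  by rewrite L2norm_cst0 mule_ge0.
have us'3 k t : D t -> (N (u t \- s' k t) <= 3%:E * N (u t))%E.
  move=> Dt; apply: le_trans (L2norm_subD (uL _ Dt) (step_curve_L2 t (s'S k))) _.
  have := s'2 k t Dt; rewrite -(L2norm_fineK (uL _ Dt)) -(L2norm_fineK (step_curve_L2 t (s'S k))).
  by rewrite -EFinD -!EFinM !lee_fin => ?; lra.
have us' t : D t -> N (u t \- s' k t) @[k --> \oo] --> 0%E.
  move=> Dt; have [Nu0|Nu0] := eqVneq (N (u t)) 0%E.
    apply: cvge0_le (cvg_cst 0%E) => //; apply: nearW => k.
    by have := us'3 k t Dt; rewrite Nu0 mule0.
  apply/cvge0P => // e e0.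
  have Nut : 0 < fine (N (u t)).
    by rewrite fine_gt0// lt0e Nu0 L2norm_ge0 L2norm_lty// uL.
  have /cvge0P us0 := us t Dt.
  have us1 := us0 (fun=> L2norm_ge0 _ _) _ e0.
  have us2 := us0 (fun=> L2norm_ge0 _ _) _ Nut.
  near=> k.
  have us1k : (N (u t \- s k t) <= e%:E)%E by near: k; exact: us1.
  have us2k : (N (u t \- s k t) <= N (u t))%E.
    by rewrite -(L2norm_fineK (uL _ Dt)); near: k; exact: us2.
  rewrite /s' ifT//; apply/mem_set; split => //=.
  apply: le_trans (L2norm_le_sub (step_curve_L2 t (sS k)) (uL _ Dt)) _.
  have -> : (2%:E * N (u t) = N (u t) + N (u t))%E.
    by rewrite -(L2norm_fineK (uL _ Dt)) -EFinM -EFinD; congr EFin; ring.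
  by rewrite L2normB leeD2r.
have u_s' : L1L2norm nu D (fun t => u t \- s' k t) @[k --> \oo] --> 0%E.
  have g_int : leb.-integrable D (fun t => 3%:E * N (u t))%E.
    apply: integrableZl => //; apply/integrableP; split => //.
    by under eq_integral do rewrite gee0_abs//.
  have ae_cvg : {ae leb, forall t, D t -> N (u t \- s' k t) @[k --> \oo] --> cst 0%E t}.
    exact: nearW.
  have ae_dom : {ae leb, forall t k, D t -> (`|N (u t \- s' k t)| <= 3%:E * N (u t))%E}.
    by apply: nearW => t k Dt; rewrite gee0_abs// us'3.
  have [_ _] := @dominated_convergence _ _ _ leb D mD
    (fun k t => N (u t \- s' k t)) (cst 0%E) _
    (fun k => measurable_L2norm_curve mD Doo (us'm k))
    (measurable_cst _) ae_cvg g_int ae_dom.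
  by rewrite integral0.
have V k := (step_integral mD Doo (s'S k)).
pose W k (x : X) := \int[leb]_(t in D) s' k t x.
have WL k : W k \in L2 by have [] := V k.
have [v vL Wv] : exists2 v, v \in L2 & N (W n \- v) @[n --> \oo] --> 0%E.
  apply: L2_complete => // e e0.
  have e2 : 0 < e / 2 by rewrite divr_gt0.
  have /cvge0P us'0 := u_s'.
  have [n0 _ n0P] := us'0 (fun=> L1L2norm_ge0 _ _ _) _ e2.
  exists n0 => m n mn0 nn0.
  have -> : W m \- W n = (fun x => \int[leb]_(t in D) (s' m t \- s' n t) x).
    by apply/funext => x; rewrite (step_integralB x mD Doo (s'S m) (s'S n)).
  have dS : step_curve nu (fun t => s' m t \- s' n t).
    by apply: (step_comp2 (F := fun h g => h \- g)) => // h g; exact: L2_sub.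
  have [_ /le_trans] := step_integral mD Doo dS; apply.
  rewrite (splitr e) EFinD; apply: le_trans (leeD (n0P m mn0) (n0P n nn0)).
  apply: le_L1L2normD => //; first exact: step_strongly_measurable.
  move=> t Dt; rewrite (L2normB nu (u t) (s' m t)).
  by apply: L2norm_subsub; [exact: step_curve_L2|exact: step_curve_L2|exact: uL].
by exists v; apply/is_Bochner_stepP; split => //; exists s'; split.
Unshelve. all: by end_near. Qed.

End domain.

(** Integrals over different intervals become comparable once they are seen as
    integrals over a common one. *)
Lemma Bochner_restrict u v (D' D : set R) : measurable D' -> measurable D ->
  (leb D < +oo)%E -> D' `<=` D -> is_Bochner_integral nu D' u v ->
  is_Bochner_integral nu D (fun t => if t \in D' then u t else cst 0) v.
Proof.
move=> mD' mD Doo sub.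
have D'oo : (leb D' < +oo)%E.
  by apply: le_lt_trans Doo; apply: le_measure; rewrite ?inE.
move=> /(is_Bochner_stepP mD' D'oo)[um vL [s [sS us sv]]].
have [uL [r [rS ur]]] := (strongly_measurable_stepP _ mD' D'oo u).1 um.
apply/(is_Bochner_stepP mD Doo); split => //.
  apply/(strongly_measurable_stepP _ mD Doo); split.
    move=> t Dt; case: ifPn => [/set_mem/uL//|_]; exact: L2_cst0.
  exists (fun k t => if t \in D' then r k t else cst 0); split.
    by move=> k; exact: step_if.
  move=> t Dt; case: ifPn => [/set_mem/ur//|_].
  rewrite (_ : (fun k => _) = cst 0%E); first exact: cvg_cst.
  by apply/funext => k; rewrite fun_subrr L2norm_cst0.
exists (fun k t => if t \in D' then s k t else cst 0); split.
- by move=> k; exact: step_if.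
- rewrite (_ : (fun k => _) = (fun k => L1L2norm nu D' (fun t => u t \- s k t)))//.
  apply/funext => k; rewrite /L1L2norm.
  rewrite -[in RHS](setIidl sub) integral_mkcondl.
  apply: eq_integral => t _; rewrite patchE; case: ifPn => // _.
  by rewrite fun_subrr L2norm_cst0.
- rewrite (_ : (fun k => _) = (fun k => N ((fun x => \int[leb]_(t in D') s k t x) \- v)))//.
  apply/funext => k; congr (N (_ \- _)); apply/funext => x.
  rewrite -[in RHS](setIidl sub) /Rintegral integral_mkcondl; congr fine.
  by apply: eq_integral => t _; rewrite patchE; case: ifPn.
Qed.

End Bochner_theory.

(** * An exponential weight and the Gronwall inequality *)

Section gronwall.
Context {R : realType}.
Local Notation leb := (@lebesgue_measure R).

(** The weight for an integrable rate b on the real line that vanishes on the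
    nonpositive reals. *)
Section weight_line.
Variable b : R -> R.
Hypotheses (b0 : forall t, 0 <= b t) (b_neg : forall t, t <= 0 -> b t = 0)
  (bi : leb.-integrable setT (EFin \o b)).

Let mb : measurable_fun setT (EFin \o b).
Proof. by case/integrableP : bi. Qed.

Let B (t : R) := fine (\int[leb]_(s in `]-oo, t[) (b s)%:E).

Let bE A : measurable A ->
  (\int[leb]_(s in A) (b s)%:E)%E \is a fin_num.
Proof.
move=> mA; rewrite integrable_fin_num//.
exact: (integrableS measurableT mA (@subsetT _ A) bi).
Qed.

Let BE t : (\int[leb]_(s in `]-oo, t[) (b s)%:E)%E = (B t)%:E.
Proof. by rewrite fineK// bE. Qed.

Let itv_split (p t : R) : p <= t -> `]-oo, t[%classic = `]-oo, p[%classic `|` `[p, t[%classic.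
Proof.
move=> pt; apply/seteqP; split => s /=; rewrite !in_itv/=.
  by move=> st; case: (ltP s p) => sp; [left|right].
by move=> [sp|/andP[]//]; exact: lt_le_trans sp pt.
Qed.

Let integral_split (p t : R) (f : R -> \bar R) : p <= t -> measurable_fun setT f ->
  (forall s, (0 <= f s)%E) ->
  (\int[leb]_(s in `]-oo, t[) f s =
   \int[leb]_(s in `]-oo, p[) f s + \int[leb]_(s in `[p, t[) f s)%E.
Proof.
move=> pt mf f0; rewrite (itv_split pt) ge0_integral_setU//.
- by apply: (measurable_funS measurableT _ mf).
- apply/disj_set2P; apply/seteqP; split => // s [] /=; rewrite !in_itv/=.
  by move=> sp /andP[/le_lt_trans/(_ sp)]; rewrite ltxx.
Qed.

Let BD (p t : R) : p <= t -> (\int[leb]_(s in `[p, t[) (b s)%:E)%E = (B t - B p)%:E.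
Proof.
move=> pt; have mI : measurable `[p, t[%classic by exact: measurable_itv.
have := integral_split pt mb (fun s => b0 s : (0 <= (b s)%:E)%E).
rewrite (BE t) (BE p) -(fineK (bE mI)) -EFinD => -[->].
by rewrite addrAC subrr add0r.
Qed.

Let B_nd : {homo B : p t / p <= t}.
Proof.
move=> p t pt; rewrite -subr_ge0 -lee_fin -BD//.
by apply: integral_ge0 => s _; rewrite lee_fin.
Qed.

Let w t := expR (4 * B t).

Let w_nd : {homo w : p t / p <= t}.
Proof. by move=> p t pt; rewrite ler_expR ler_pM2l// B_nd. Qed.

Let mw : measurable_fun setT w.
Proof. exact: nondecreasing_measurable. Qed.

Let B_step : exists2 e : R, 0 < e & forall t, B t - B (t - e) <= 4^-1.
Proof.
have e4 : 0 < 4^-1 :> R by rewrite invr_gt0.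
have [e [e0 eP]] := integral_normr_continuous bi e4.
have e2 : 0 < e / 2 by rewrite divr_gt0.
exists (e / 2) => // t.
have tt : t - e / 2 <= t by rewrite gerBl ltW.
have mI : measurable `[t - e / 2, t[%classic by exact: measurable_itv.
have lI : (leb `[(t - e / 2)%R, t[%classic < e%:E)%E.
  by rewrite lebesgue_measure_itv/= lte_fin gtrBl e2 -EFinB lte_fin; lra.
have /ltW H := eP _ mI lI; rewrite -lee_fin -BD//; move: H; rewrite -lee_fin /Rintegral.
have -> : (\int[leb]_(s in `[(t - e / 2)%R, t[) `|b s|%:E = \int[leb]_(s in `[(t - e / 2)%R, t[) (b s)%:E)%E.
  by apply: eq_integral => s _; rewrite ger0_norm.
by rewrite fineK ?bE.
Qed.

Let B_ge0 t : 0 <= B t.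
Proof. by rewrite fine_ge0//; apply: integral_ge0 => s _; rewrite lee_fin. Qed.

Let B_le t : B t <= fine (\int[leb]_s (b s)%:E).
Proof.
apply: fine_le; rewrite ?bE//.
by apply: ge0_subset_integral => //= s _; rewrite lee_fin.
Qed.

(* x <= (1 - exp(- 4 x)) / 2 for 0 <= x <= 1/4; the choice of the factor 4 in the
   weight ensures the constant 1/2. *)
Let expR_step (p t : R) : p <= t -> B t - B p <= 4^-1 ->
  w t * (B t - B p) <= 2^-1 * (w t - w p).
Proof.
move=> pt Bpt.
have wt0 : 0 < w t by exact: expR_gt0.
have -> : w p = w t * (expR (4 * (B t - B p)))^-1.
  by rewrite -expRN -expRD; congr expR; ring.
set x := B t - B p in Bpt *.
have x0 : 0 <= x by rewrite subr_ge0 B_nd.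
have ex : 1 + 4 * x <= expR (4 * x) by exact: expR_ge1Dx.
have : (expR (4 * x))^-1 <= 1 - 2 * x.
  rewrite -[leLHS]mul1r ler_pdivrMr ?expR_gt0//.
  apply: (@le_trans _ _ ((1 - 2 * x) * (1 + 4 * x))); first nra.
  by apply: ler_wpM2l => //; lra.
set y := _^-1 => yx.
rewrite [leRHS](_ : _ = w t * (2^-1 * (1 - y))); last by ring.
by apply: ler_wpM2l; [exact: ltW|lra].
Qed.

(* B increases by at most 1/4 over any interval of length e, and the integral up
   to r is controlled by induction on the number of such intervals in [0, r]. *)
Let weightP t : (\int[leb]_(s in `]-oo, t[) ((b s)%:E * (w s)%:E) <=
  (2^-1 * w t)%:E)%E.
Proof.
have [e e0 Be] := B_step.
have mbw : measurable_fun setT (fun s => (b s)%:E * (w s)%:E)%E.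
  by apply: emeasurable_funM => //; exact/measurable_EFinP.
have bw0 s : (0 <= (b s)%:E * (w s)%:E)%E.
  by rewrite -EFinM lee_fin mulr_ge0// expR_ge0.
suff H : forall (n : nat) r, r <= n%:R * e ->
    (\int[leb]_(s in `]-oo, r[) ((b s)%:E * (w s)%:E) <= (2^-1 * w r)%:E)%E.
  apply: (H (Num.trunc (t / e)).+1); rewrite -ler_pdivrMr//.
  have [te|te] := leP 0 (t / e); first by have /andP[_ /ltW] := truncn_itv te.
  by rewrite (le_trans (ltW te)).
elim => [r|n ih r rn].
  rewrite mul0r => r0; rewrite integral0_eq.
    by rewrite lee_fin mulr_ge0// expR_ge0.
  by move=> s; rewrite /= in_itv/= => sr; rewrite b_neg ?mul0e// ltW// (lt_le_trans sr).
have rr : r - e <= r by rewrite gerBl ltW.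
rewrite (integral_split rr mbw bw0).
have rn' : r - e <= n%:R * e by rewrite lerBlDr; move: rn; rewrite -natr1 mulrDl mul1r.
apply: le_trans (leeD (ih _ rn') (_ : (_ <= (w r * (B r - B (r - e)))%:E)%E)) _.
  rewrite EFinM -(BD rr) -ge0_integralZl_EFin//; last 3 first.
  - by move=> s _; rewrite lee_fin.
  - by apply: (measurable_funS measurableT _ mb).
  - exact: expR_ge0.
  apply: ge0_le_integral => //.
  - by apply: (measurable_funS measurableT _ mbw).
  - by apply: measurable_funeM; apply: (measurable_funS measurableT _ mb).
  - move=> s /=; rewrite in_itv/= => /andP[_ /ltW sr].
    by rewrite muleC lee_wpmul2r ?lee_fin// w_nd.
rewrite -EFinD lee_fin.
have := expR_step rr (Be r); lra.
Qed.

Lemma weight_line : exists w : R -> R, [/\ measurable_fun setT w,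
  forall t, 1 <= w t <= expR (4 * fine (\int[leb]_s (b s)%:E)) &
  forall t, (\int[leb]_(s in `]-oo, t[) ((b s)%:E * (w s)%:E) <= (2^-1 * w t)%:E)%E].
Proof.
exists w; split => // t; rewrite /w ler_expR ler_pM2l// B_le andbT.
by rewrite -expR0 ler_expR mulr_ge0.
Qed.

End weight_line.

Variables (T : R) (beta : R -> \bar R).
Hypotheses (beta_ge0 : forall t, (0 <= beta t)%E)
  (mbeta : measurable_fun `]0, T[%classic beta)
  (beta_fin : forall t, `]0, T[%classic t -> beta t \is a fin_num)
  (beta_lty : (\int[leb]_(t in `]0%R, T[) beta t < +oo)%E).

(** On [0, T] the weight is exp(4 int_0^t beta). *)
Lemma weight_exists : exists w : R -> R, [/\ measurable_fun setT w,
  forall t, 1 <= w t <= expR (4 * fine (\int[leb]_(t in `]0%R, T[) beta t)) &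
  forall t, t \in `[0, T] ->
    (\int[leb]_(s in `]0%R, t[) (beta s * (w s)%:E) <= (2^-1 * w t)%:E)%E].
Proof.
pose b t := fine ((beta \_ `]0, T[) t).
have bE t : (b t)%:E = (beta \_ `]0, T[) t.
  by rewrite /b fineK// patchE; case: ifPn => // /set_mem/beta_fin.
have b0 t : 0 <= b t by rewrite -lee_fin bE patchE; case: ifPn.
have b_neg t : t <= 0 -> b t = 0.
  move=> t0; rewrite /b patchE memNset//= in_itv/=.
  by move=> /andP[/lt_le_trans/(_ t0)]; rewrite ltxx.
have mI (r : R) : measurable (`]0, r[%classic : set R) by exact: measurable_itv.
have bI : (\int[leb]_t (b t)%:E = \int[leb]_(t in `]0%R, T[) beta t)%E.
  by rewrite [RHS]integral_mkcond; apply: eq_integral => t _; exact: bE.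
have bi : leb.-integrable setT (EFin \o b).
  apply/integrableP; split.
    rewrite (_ : _ \o _ = beta \_ `]0, T[); last by apply/funext => t; exact: bE.
    exact: (measurable_restrictT beta (mI T)).1 mbeta.
  under eq_integral do rewrite /= ger0_norm//.
  by rewrite bI.
have [w [mw w1 wP]] := weight_line b0 b_neg bi.
exists w; split => //; first by move=> t; rewrite -bI.
move=> t; rewrite in_itv/= => /andP[t0 tT].
apply: le_trans (wP t); rewrite le_eqVlt; apply/orP; left; apply/eqP.
rewrite integral_mkcond [RHS]integral_mkcond; apply: eq_integral => s _.
rewrite !patchE bE patchE; case: ifPn => [/set_mem/=|].
  rewrite in_itv/= => /andP[s0 st]; rewrite !mem_set//= in_itv/= ?st//.
  by rewrite s0 (lt_le_trans st).
move=> /negP st; case: ifPn => // /set_mem/=; rewrite in_itv/= => st'.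
rewrite memNset ?mul0e//= in_itv/= => /andP[s0 _].
by apply: st; apply/mem_set; rewrite /= in_itv/= s0.
Qed.

Section weighted_bound.
Variables (w : R -> R).
Hypotheses (mw : measurable_fun setT w) (w1 : forall t, 1 <= w t)
  (wP : forall t, t \in `[0, T] ->
    (\int[leb]_(s in `]0%R, t[) (beta s * (w s)%:E) <= (2^-1 * w t)%:E)%E).

(** A function bounded by a multiple of the weight is halved, relative to the
    weight, by integration against beta. *)
Lemma weight_half (phi : R -> \bar R) (m t : R) : 0 <= m -> t \in `[0, T] ->
  measurable_fun `]0, T[%classic phi ->
  (forall s, `]0, T[%classic s -> (0 <= phi s <= (m * w s)%:E)%E) ->
  (\int[leb]_(s in `]0%R, t[) (beta s * phi s) <= (m / 2 * w t)%:E)%E.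
Proof.
move=> m0 tT mphi phiw.
have sub : `]0, t[%classic `<=` `]0, T[%classic.
  move: tT; rewrite in_itv/= => /andP[_ tT] s/=; rewrite !in_itv/= => /andP[-> st].
  exact: lt_le_trans st tT.
have mI (r : R) : measurable (`]0, r[%classic : set R) by exact: measurable_itv.
have mb : measurable_fun `]0, t[%classic beta by exact: (measurable_funS (mI T) sub).
have mp : measurable_fun `]0, t[%classic phi by exact: (measurable_funS (mI T) sub).
have mw' : measurable_fun `]0, t[%classic (EFin \o w).
  by apply/measurable_EFinP; exact: (measurable_funS measurableT).
apply: (@le_trans _ _ (\int[leb]_(s in `]0%R, t[) (m%:E * (beta s * (w s)%:E)))%E).
  apply: ge0_le_integral => //.
  - by move=> s /sub sT; rewrite mule_ge0//; have /andP[] := phiw _ sT.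
  - exact: emeasurable_funM.
  - by apply: measurable_funeM; exact: emeasurable_funM.
  - move=> s /sub sT; have /andP[p0 pm] := phiw _ sT.
    by rewrite muleCA -EFinM lee_wpmul2l.
rewrite ge0_integralZl_EFin//; last 2 first.
- by move=> s _; rewrite mule_ge0// lee_fin (le_trans _ (w1 s)).
- exact: emeasurable_funM.
apply: (@le_trans _ _ (m%:E * (2^-1 * w t)%:E)%E).
  by rewrite lee_wpmul2l ?lee_fin// wP.
by rewrite -EFinM lee_fin mulrA.
Qed.

End weighted_bound.

Lemma gronwall (phi : R -> \bar R) (c M : R) : 0 <= c ->
  measurable_fun `]0, T[%classic phi ->
  (forall t, t \in `[0, T] -> (0 <= phi t <= M%:E)%E) ->
  (forall t, t \in `[0, T] ->
    (phi t <= c%:E + \int[leb]_(s in `]0%R, t[) (beta s * phi s))%E) ->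
  forall t, t \in `[0, T] ->
    (phi t <= (2 * c * expR (4 * fine (\int[leb]_(t in `]0%R, T[) beta t)))%:E)%E.
Proof.
move=> c0 mphi phiM phiI.
have [w [mw w1 wP]] := weight_exists.
have w1' t : 1 <= w t by case/andP: (w1 t).
(* each application of weight_half halves the contribution of the a priori
   bound M *)
have H (n : nat) t : t \in `[0, T] ->
    (phi t <= ((2 * c + `|M| * 2^-1 ^+ n) * w t)%:E)%E.
  elim: n t => [t tT|n ih t tT].
    have /andP[_ /le_trans] := phiM t tT; apply.
    rewrite lee_fin expr0 mulr1 (le_trans (ler_norm _))//.
    rewrite (@le_trans _ _ (2 * c + `|M|))// ?lerDr ?mulr_ge0//.
    by rewrite ler_peMr ?addr_ge0 ?mulr_ge0.
  have m0 : 0 <= 2 * c + `|M| * 2^-1 ^+ n.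
    by rewrite addr_ge0 ?mulr_ge0 ?exprn_ge0.
  have sub s : `]0, T[%classic s -> s \in `[0, T].
    by rewrite /= !in_itv/= => /andP[/ltW -> /ltW ->].
  have := weight_half mw w1' wP m0 tT mphi.
  move=> /(_ _)/(leeD (lexx c%:E))/(le_trans (phiI _ tT))/le_trans; apply.
    by move=> s /sub sT; rewrite ih// andbT; case/andP: (phiM _ sT).
  rewrite -EFinD lee_fin exprS; have := w1' t => wt1.
  have : c <= c * w t by rewrite ler_peMr.
  by move=> cw; rewrite !mulrDl; nra.
move=> t tT; apply: (@le_trans _ _ (2 * c * w t)%:E); last first.
  by rewrite lee_fin ler_wpM2l ?mulr_ge0//; case/andP: (w1 t).
have cv : (2 * c + `|M| * 2^-1 ^+ n) * w t @[n --> \oo] --> (2 * c + 0) * w t.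
  apply: cvgMl; apply: cvgD; first exact: cvg_cst.
  have : geometric `|M| 2^-1 @ \oo --> (0 : R).
    by apply: cvg_geometric; rewrite ger0_norm//; lra.
  by [].
rewrite addr0 in cv.
by apply: (cvge_to_ge (cvg_EFin_comp cv)); apply: nearW => n; exact: H.
Qed.

End gronwall.

(** * Continuous curves in L^2 *)

Section continuous_curves.
Context {R : realType} {d} {X : measurableType d}.
Variable nu : {measure set X -> \bar R}.
Local Notation leb := (@lebesgue_measure R).
Local Notation L2 := (Lfun nu 2%:E).
Local Notation N := (L2norm nu).
Implicit Types (u v : R -> X -> R) (T : R).

Lemma measurable_oo (a b : R) : measurable (`]a, b[%classic : set R).
Proof. exact: measurable_itv. Qed.

Lemma lebesgue_oo_lty (a b : R) : (leb `]a, b[%classic < +oo)%E.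
Proof. by rewrite lebesgue_measure_itv/=; case: ifPn => _; rewrite ?ltry// -EFinB ltry. Qed.

Lemma subset_oo (t T : R) : t <= T -> `]0, t[%classic `<=` `]0, T[%classic.
Proof. by move=> tT s /=; rewrite !in_itv/= => /andP[-> /lt_le_trans]; exact. Qed.

Lemma strongly_measurableS (D D' : set R) u : D' `<=` D ->
  strongly_measurable nu D u -> strongly_measurable nu D' u.
Proof.
move=> sub [uL [s [sS us]]]; split; first by move=> t /sub; exact: uL.
by exists s; split => // t /sub; exact: us.
Qed.

Lemma in_CL2_ball T u t (e : R) : in_CL2 nu T u -> t \in `[0, T] -> 0 < e ->
  exists2 r : R, 0 < r & forall s, s \in `[0, T] -> `|s - t| < r ->
    (N (u s \- u t) <= e%:E)%E.
Proof.
move=> [uL uc] tT e0.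
have /cvge0P := uc t tT => /(_ (fun=> L2norm_ge0 _ _) _ e0).
move=> /nbhs_ballP[r /= r0 rP]; exists r => // s sT st.
by apply: rP => //; rewrite /ball/= distrC.
Qed.

Lemma in_CL2P T u : (forall t, t \in `[0, T] -> u t \in L2) ->
  (forall t (e : R), t \in `[0, T] -> 0 < e ->
    exists2 r : R, 0 < r & forall s, s \in `[0, T] -> `|s - t| < r ->
    (N (u s \- u t) <= e%:E)%E) -> in_CL2 nu T u.
Proof.
move=> uL uc; split => // t tT; apply/cvge0P => // e e0.
have [r r0 rP] := uc t e tT e0.
apply/nbhs_ballP; exists r => //= s; rewrite /ball/= distrC => st sT.
exact: rP.
Qed.

Lemma in_CL2_cst T h : h \in L2 -> in_CL2 nu T (fun=> h).
Proof.
move=> hL; apply: in_CL2P => // t e _ e0; exists 1 => // s _ _.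
by rewrite fun_subrr L2norm_cst0 lee_fin ltW.
Qed.

Lemma in_CL2_add T u v : in_CL2 nu T u -> in_CL2 nu T v ->
  in_CL2 nu T (fun t => u t \+ v t).
Proof.
move=> uC vC; have [uL _] := uC; have [vL _] := vC.
apply: in_CL2P => [t tT|t e tT e0]; first by apply: L2_add; [exact: uL|exact: vL].
have e2 : 0 < e / 2 by rewrite divr_gt0.
have [r r0 rP] := in_CL2_ball uC tT e2.
have [q q0 qP] := in_CL2_ball vC tT e2.
exists (Num.min r q) => [|s sT]; rewrite lt_min ?r0 ?q0// => /andP[sr sq].
have -> : (u s \+ v s) \- (u t \+ v t) = (u s \- u t) \+ (v s \- v t).
  by apply/funext => x /=; ring.
rewrite (splitr e) EFinD; apply: le_trans (leeD (rP s sT sr) (qP s sT sq)).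
by apply: L2normD; apply: L2_sub; do ?[exact: uL|exact: vL].
Qed.

Lemma in_CL2_bounded T u : 0 <= T -> in_CL2 nu T u ->
  exists2 M : R, 0 <= M & forall t, t \in `[0, T] -> (N (u t) <= M%:E)%E.
Proof.
move=> T0 uC; have [uL _] := uC.
have cN : {within `[0, T], continuous (fun t => fine (N (u t)))}.
  apply/subspace_continuousP => t tT; apply/cvgrPdist_le => e e0.
  have [r r0 rP] := in_CL2_ball uC tT e0.
  apply/nbhs_ballP; exists r => //= s; rewrite /ball/= distrC => st sT.
  have H := rP s sT st.
  suff : `|fine (N (u t)) - fine (N (u s))| <= e by [].
  have := L2norm_le_sub (uL _ sT) (uL _ tT).
  have := L2norm_le_sub (uL _ tT) (uL _ sT).
  rewrite (L2normB nu (u t) (u s)); move: H.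
  rewrite -(L2norm_fineK (uL _ sT)) -(L2norm_fineK (uL _ tT)).
  rewrite -(L2norm_fineK (L2_sub (uL _ sT) (uL _ tT))) -!EFinD !lee_fin.
  by rewrite /= ler_distl => *; apply/andP; split; lra.
have [c cT cmax] := EVT_max T0 cN.
exists (fine (N (u c))); first by rewrite fine_ge0.
move=> t tT; rewrite -(L2norm_fineK (uL _ tT)) lee_fin; exact: cmax.
Qed.

(** The curve is approximated, on a uniform grid, by its values at the left
    grid points. *)
Lemma in_CL2_strongly_measurable T u : 0 < T -> in_CL2 nu T u ->
  strongly_measurable nu `]0, T[%classic u.
Proof.
move=> T0 uC; have [uL _] := uC.
apply/(strongly_measurable_stepP nu (measurable_oo 0 T) (lebesgue_oo_lty 0 T)); split.
  by move=> t /=; rewrite in_itv/= => /andP[t0 tT]; apply: uL; rewrite in_itv/= !ltW.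
(* q k t is the number of the cell of t in the grid of mesh T / k.+1; the minimum
   with k keeps it below k.+1 also for t outside [0, T[ *)
pose q (k : nat) (t : R) := minn (Num.trunc (t * k.+1%:R / T)) k.
have q_nd k : {homo (fun t => (q k t)%:R : R) : s t / s <= t}.
  move=> s t st; rewrite ler_nat /q.
  have : (Num.trunc (s * k.+1%:R / T) <= Num.trunc (t * k.+1%:R / T))%N.
    by apply: le_truncn; rewrite ler_pM2r ?invr_gt0// ler_pM2r.
  by rewrite leq_min geq_minr andbT; apply: leq_trans; exact: geq_minl.
have qk k t : (q k t < k.+1)%N by rewrite ltnS geq_minr.
pose c (k : nat) (t : R) : 'I_k.+1 := Ordinal (qk k t).
pose p (k : nat) (i : 'I_k.+1) : R := i%:R * T / k.+1%:R.
have pT k i : p k i \in `[0, T].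
  rewrite in_itv/= /p; apply/andP; split; first by rewrite divr_ge0 ?mulr_ge0// ltW.
  rewrite ler_pdivrMr// mulrC ler_pM2l// ler_nat; exact: ltnW.
exists (fun k t => u (p k (c k t))); split.
  move=> k; exists 'I_k.+1, (c k), (fun i => u (p k i)); split => // i; last exact: uL.
  have -> : c k @^-1` [set i] = setT `&` (fun t => (q k t)%:R : R) @^-1` [set (i%:R : R)].
    rewrite setTI; apply/seteqP; split => t /=.
      by move=> <-.
    by move=> /eqP; rewrite eqr_nat => /eqP qi; apply: val_inj.
  by apply: (nondecreasing_measurable measurableT (q_nd k)) => //; exact: measurable_set1.
move=> t tT; have tT' : t \in `[0, T].
  by move: tT; rewrite /= !in_itv/= => /andP[t0 tT]; rewrite !ltW.
apply/cvge0P => // e e0.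
have [r r0 rP] := in_CL2_ball uC tT' e0.
have Tr : 0 <= T / r by rewrite divr_ge0// ltW.
near=> k; rewrite L2normB; apply: rP => //.
move: tT; rewrite /= in_itv/= => /andP[t0 tT].
have x0 : 0 <= t * k.+1%:R / T by rewrite divr_ge0 ?mulr_ge0// ltW.
have xk : t * k.+1%:R / T < k.+1%:R by rewrite ltr_pdivrMr// mulrC ltr_pM2l.
have qE : q k t = Num.trunc (t * k.+1%:R / T).
  by apply/minn_idPl; rewrite -ltnS truncn_lt_nat.
have /andP[qx xq] := truncn_itv x0; rewrite -qE in qx xq.
have k0 : 0 < k.+1%:R / T by rewrite divr_gt0.
have kr : T < r * k.+1%:R.
  rewrite -ltr_pdivrMl// mulrC; apply: lt_le_trans (_ : (Num.trunc (T / r)).+1%:R <= _).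
    by have /andP[] := truncn_itv Tr.
  by rewrite ler_nat ltnS; near: k; exact: nbhs_infty_ge.
rewrite /p /=.
have -> : (q k t)%:R * T / k.+1%:R - t = ((q k t)%:R - t * k.+1%:R / T) * (T / k.+1%:R).
  by move: (k.+1%:R : R) (ltr0Sn R k) => K K0; field; rewrite !gt_eqF.
have Tk : 0 < T / k.+1%:R by rewrite divr_gt0.
rewrite normrM (gtr0_norm Tk) -ltr_pdivlMr// distrC ger0_norm ?subr_ge0//.
apply: (@lt_trans _ _ 1); first by move: xq; rewrite -natr1; lra.
by rewrite ltr_pdivlMr// mul1r ltr_pdivrMr.
Unshelve. all: by end_near. Qed.

Lemma le_L1L2normS (D D' : set R) u : measurable D -> (leb D < +oo)%E ->
  measurable D' -> D' `<=` D -> strongly_measurable nu D u ->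
  (L1L2norm nu D' u <= L1L2norm nu D u)%E.
Proof.
move=> mD Doo mD' sub um; apply: ge0_subset_integral => //.
exact: (measurable_L2norm_curve mD Doo um).
Qed.

(** The indefinite Bochner integral is a continuous curve. *)
Lemma Bochner_primitive T g : 0 < T -> in_L1L2 nu `]0, T[%classic g ->
  exists V, in_CL2 nu T V /\
    forall t, t \in `[0, T] -> is_Bochner_integral nu `]0, t[%classic g (V t).
Proof.
move=> T0 [gm goo].
have mD r := measurable_oo 0 r; have Doo r := lebesgue_oo_lty 0 r.
have exV t : exists h, t \in `[0, T] -> is_Bochner_integral nu `]0, t[%classic g h.
  have [tT|] := boolP (t \in `[0, T]); last by exists (cst 0).
  have /andP[_ tT'] : 0 <= t <= T by move: tT; rewrite in_itv.
  have sub := subset_oo tT'.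
  have : in_L1L2 nu `]0, t[%classic g.
    split; first exact: strongly_measurableS gm.
    by apply: le_lt_trans goo; exact: le_L1L2normS.
  by move=> /(Bochner_exists (mD t) (Doo t))[h hP]; exists h.
have [V VP] := choice exV; exists V; split => //.
have VL t : t \in `[0, T] -> V t \in L2 by move=> /VP[].
pose b t := fine (((fun t => N (g t)) \_ `]0, T[) t).
have bE t : (b t)%:E = ((fun t => N (g t)) \_ `]0, T[) t.
  rewrite /b fineK// patchE; case: ifPn => // /set_mem tT.
  by apply: L2norm_fin_num; exact: strongly_measurable_L2 gm tT.
have b0 t : 0 <= b t.
  by rewrite -lee_fin bE patchE; case: ifPn => _; [exact: L2norm_ge0|].
have bi : leb.-integrable setT (EFin \o b).
  apply/integrableP; split.
    rewrite (_ : _ \o _ = (fun t => N (g t)) \_ `]0, T[); last by apply/funext => t; exact: bE.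
    exact: (measurable_restrictT _ (mD T)).1 (measurable_L2norm_curve (mD T) (Doo T) gm).
  under eq_integral do rewrite /= ger0_norm// bE.
  by rewrite -integral_mkcond.
have Vst s t : s \in `[0, T] -> t \in `[0, T] -> s <= t ->
    (N (V t \- V s) <= \int[leb]_(r in `[s, t[) (b r)%:E)%E.
  move=> sT tT st.
  have /andP[s0 sT'] : 0 <= s <= T by move: sT; rewrite in_itv.
  have /andP[t0 tT'] : 0 <= t <= T by move: tT; rewrite in_itv.
  have Bs := Bochner_restrict (mD s) (mD T) (Doo T) (subset_oo sT') (VP s sT).
  have Bt := Bochner_restrict (mD t) (mD T) (Doo T) (subset_oo tT') (VP t tT).
  apply: le_trans (L2norm_Bochner (mD T) (Doo T) (Bochner_sub (mD T) (Doo T) Bt Bs)) _.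
  rewrite /L1L2norm integral_mkcond [leRHS]integral_mkcond le_eqVlt.
  apply/orP; left; apply/eqP; apply: eq_integral => r _.
  rewrite !patchE bE patchE !(mem_setE, in_itv)/=.
  case: (ltP 0 r) => r0 /=; last first.
    by case: ifPn.
  case: (ltP r T) => rT /=; last by case: ifPn.
  case: (ltP r t) => rt /=; last first.
    by rewrite andbF ifF ?fun_subrr ?L2norm_cst0//; apply/negbTE; rewrite -leNgt (le_trans st).
  by case: (ltP r s) => rs /=; rewrite ?fun_subrr ?fun_subr0 ?L2norm_cst0.
apply: in_CL2P => // t e tT e0.
have [r [r0 rP]] := integral_normr_continuous bi e0.
have key s1 s2 : s1 \in `[0, T] -> s2 \in `[0, T] -> s1 <= s2 -> s2 - s1 < r ->
    (N (V s2 \- V s1) <= e%:E)%E.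
  move=> s1T s2T s12 sr; apply: le_trans (Vst _ _ s1T s2T s12) _.
  have mI : measurable `[s1, s2[%classic by exact: measurable_itv.
  have lI : (leb `[s1, s2[%classic < r%:E)%E.
    rewrite lebesgue_measure_itv/=; case: ifPn => _; last by rewrite lte_fin.
    by rewrite -EFinB lte_fin.
  have /ltW := rP _ mI lI; rewrite -lee_fin /Rintegral.
  have -> : (\int[leb]_(t in `[s1, s2[) `|b t|%:E = \int[leb]_(t in `[s1, s2[) (b t)%:E)%E.
    by apply: eq_integral => x _; rewrite ger0_norm.
  rewrite fineK// integrable_fin_num//.
  by apply: (integrableS _ _ _ bi) => //; exact: subsetT.
exists r => // s sT; have [st|ts] := leP s t => sr.
  by rewrite L2normB; apply: key => //; apply: le_lt_trans sr; rewrite distrC ler_norm.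
by apply: key => //; [exact: ltW|apply: le_lt_trans sr; exact: ler_norm].
Qed.

End continuous_curves.

(** * Evolution equations with an integrable Lipschitz constant *)

Section evolution.
Context {R : realType} {d} {X : measurableType d}.
Variable nu : {measure set X -> \bar R}.
Local Notation leb := (@lebesgue_measure R).
Local Notation L2 := (Lfun nu 2%:E).
Local Notation N := (L2norm nu).
Variables (T : R) (T0 : 0 < T).

Let mD (t : R) : measurable (`]0, t[%classic : set R) := measurable_oo 0 t.
Let Doo (t : R) : (leb `]0%R, t[%classic < +oo)%E := lebesgue_oo_lty 0 t.

Let itvP (t : R) : t \in `[0, T] -> 0 <= t /\ t <= T.
Proof. by rewrite in_itv => /andP. Qed.

Let oo_cc (t : R) : `]0, T[%classic t -> t \in `[0, T].
Proof. by rewrite /= !in_itv/= => /andP[/ltW -> /ltW ->]. Qed.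

Variable beta : R -> \bar R.
Hypotheses (beta_ge0 : forall t, (0 <= beta t)%E)
  (mbeta : measurable_fun `]0, T[%classic beta)
  (beta_fin : forall t, `]0, T[%classic t -> beta t \is a fin_num)
  (beta_lty : (\int[leb]_(t in `]0%R, T[) beta t < +oo)%E).

Local Notation K := (expR (4 * fine (\int[leb]_(t in `]0%R, T[) beta t))).

Let measurable_CL2_sub (u1 u2 : R -> X -> R) : in_CL2 nu T u1 -> in_CL2 nu T u2 ->
  measurable_fun `]0, T[%classic (fun s => N (u1 s \- u2 s)).
Proof.
move=> u1C u2C; apply: (measurable_L2norm_curve (mD T) (Doo T)).
by apply: strongly_measurable_sub => //; exact: in_CL2_strongly_measurable.
Qed.

(** Two curves whose rates differ by at most alpha plus beta times their
    distance stay as close as their initial data and the integral of alpha. *)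
Lemma evolution_stability (r1 r2 u1 u2 : R -> X -> R) (I1 I2 : X -> R)
    (alpha : R -> \bar R) (A : R) :
  in_CL2 nu T u1 -> in_CL2 nu T u2 -> I1 \in L2 -> I2 \in L2 ->
  (forall t, t \in `[0, T] -> is_Bochner_integral nu `]0, t[%classic r1 (u1 t \- I1)) ->
  (forall t, t \in `[0, T] -> is_Bochner_integral nu `]0, t[%classic r2 (u2 t \- I2)) ->
  (forall t, (0 <= alpha t)%E) -> measurable_fun `]0, T[%classic alpha ->
  0 <= A -> (\int[leb]_(t in `]0%R, T[) alpha t <= A%:E)%E ->
  (forall s, `]0, T[%classic s ->
    (N (r1 s \- r2 s) <= alpha s + beta s * N (u1 s \- u2 s))%E) ->
  forall t, t \in `[0, T] ->
    (N (u1 t \- u2 t) <= (2 * (fine (N (I1 \- I2)) + A) * K)%:E)%E.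
Proof.
move=> u1C u2C I1L I2L B1 B2 a0 ma A0 aA r12.
have [u1L _] := u1C; have [u2L _] := u2C.
have [M M0 uM] : exists2 M : R, 0 <= M &
    forall t, t \in `[0, T] -> (N (u1 t \- u2 t) <= M%:E)%E.
  have [M1 M10 uM1] := in_CL2_bounded (ltW T0) u1C.
  have [M2 M20 uM2] := in_CL2_bounded (ltW T0) u2C.
  exists (M1 + M2); first exact: addr_ge0.
  move=> t tT; rewrite EFinD; apply: le_trans (leeD (uM1 t tT) (uM2 t tT)).
  by apply: L2norm_subD; [exact: u1L|exact: u2L].
apply: (gronwall beta_ge0 mbeta beta_fin beta_lty
  (phi := fun t => N (u1 t \- u2 t)) (M := M)).
- by rewrite addr_ge0// fine_ge0.
- exact: measurable_CL2_sub.
- by move=> t tT; rewrite uM// andbT.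
move=> t tT; have [t0 tT'] := itvP tT.
have sub := subset_oo tT'.
have [v1L v2L] : u1 t \- I1 \in L2 /\ u2 t \- I2 \in L2.
  by split; apply: L2_sub => //; [exact: u1L|exact: u2L].
have -> : u1 t \- u2 t = (I1 \- I2) \+ ((u1 t \- I1) \- (u2 t \- I2)).
  by apply/funext => x /=; ring.
apply: le_trans (L2normD (L2_sub I1L I2L) (L2_sub v1L v2L)) _.
rewrite EFinD L2norm_fineK ?L2_sub// -addeA leeD2l//.
have BB := Bochner_sub (mD t) (Doo t) (B1 t tT) (B2 t tT).
apply: le_trans (L2norm_Bochner (mD t) (Doo t) BB) _.
have mbu : measurable_fun `]0, T[%classic (fun s => beta s * N (u1 s \- u2 s))%E.
  by apply: emeasurable_funM => //; exact: measurable_CL2_sub.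
have mat : measurable_fun `]0, t[%classic alpha by exact: measurable_funS sub ma.
have mbut : measurable_fun `]0, t[%classic (fun s => beta s * N (u1 s \- u2 s))%E.
  exact: measurable_funS sub mbu.
have [rm _ _] := BB.
apply: (@le_trans _ _ (\int[leb]_(s in `]0%R, t[) (alpha s + beta s * N (u1 s \- u2 s)))%E).
  apply: (le_L1L2norm (mD t) (Doo t) rm); first exact: emeasurable_funD.
  by move=> s /sub; exact: r12.
rewrite ge0_integralD//; last by move=> s _; rewrite mule_ge0.
rewrite leeD2r//; apply: le_trans aA.
by apply: ge0_subset_integral => //; exact: measurable_oo.
Qed.

(** The field F of the equation f' = F s f, with initial datum fI. *)
Variables (F : R -> (X -> R) -> X -> R) (fI : X -> R).
Hypotheses (fIL : fI \in L2)
  (Fm : forall u, in_CL2 nu T u ->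
    strongly_measurable nu `]0, T[%classic (fun s => F s (u s)))
  (Flip : forall s p q, `]0, T[%classic s -> p \in L2 -> q \in L2 ->
    (N (F s p \- F s q) <= beta s * N (p \- q))%E)
  (F0_lty : (L1L2norm nu `]0%R, T[%classic (fun s => F s (cst 0%R)) < +oo)%E).

Let F_L1L2 u : in_CL2 nu T u -> in_L1L2 nu `]0, T[%classic (fun s => F s (u s)).
Proof.
move=> uC; split; first exact: Fm.
have [uL _] := uC.
have [M M0 uM] := in_CL2_bounded (ltW T0) uC.
have zC : in_CL2 nu T (fun=> cst 0) by apply: in_CL2_cst; exact: L2_cst0.
have Fum := Fm uC; have F0m := Fm zC.
have mF0 := measurable_L2norm_curve (mD T) (Doo T) F0m.
apply: (@le_lt_trans _ _
    (\int[leb]_(s in `]0%R, T[) (N (F s (cst 0%R)) + M%:E * beta s))%E).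
  apply: (le_L1L2norm (mD T) (Doo T) Fum).
    by apply: emeasurable_funD => //; exact: measurable_funeM.
  move=> s sT; have uLs := uL _ (oo_cc sT).
  have FuL := strongly_measurable_L2 Fum sT; have F0L := strongly_measurable_L2 F0m sT.
  apply: le_trans (L2norm_le_sub FuL F0L) _.
  rewrite addeC leeD2l//; apply: le_trans (Flip sT uLs (L2_cst0 nu)) _.
  rewrite muleC lee_wpmul2r// (_ : _ \- cst 0 = u s) ?uM ?oo_cc//.
  by apply/funext => x /=; rewrite subr0.
rewrite ge0_integralD//; last 2 first.
- by move=> s _; rewrite mule_ge0.
- exact: measurable_funeM.
rewrite ge0_integralZl_EFin// lte_add_pinfty// lte_mul_pinfty//.
Qed.

(* One Picard iteration. *)
Let picard_step u : exists U, in_CL2 nu T u -> in_CL2 nu T U /\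
  forall t, t \in `[0, T] ->
    is_Bochner_integral nu `]0, t[%classic (fun s => F s (u s)) (U t \- fI).
Proof.
have [uC|] := pselect (in_CL2 nu T u); last by exists (fun=> cst 0).
have [V [VC VP]] := Bochner_primitive T0 (F_L1L2 uC).
exists (fun t => V t \+ fI) => _; split.
  by apply: in_CL2_add => //; exact: in_CL2_cst.
move=> t tT; rewrite (_ : _ \- fI = V t); first exact: VP.
by apply/funext => x /=; rewrite addrK.
Qed.

(** The solution is the limit of the Picard iterates of the constant curve fI. *)
Lemma evolution_exists : exists f, in_CL2 nu T f /\
  forall t, t \in `[0, T] ->
    is_Bochner_integral nu `]0, t[%classic (fun s => F s (f s)) (f t \- fI).
Proof.
have [P PP] := choice picard_step.
have [w [mw w1K wP]] := weight_exists beta_ge0 mbeta beta_fin beta_lty.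
have w1 t : 1 <= w t by case/andP: (w1K t).
have wK t : w t <= K by case/andP: (w1K t).
have w0 t : 0 <= w t by exact: le_trans (w1 t).
(* the Picard map P is a contraction of ratio 1/2 for the weighted distance *)
have half (u v : R -> X -> R) (m t : R) : in_CL2 nu T u -> in_CL2 nu T v ->
    0 <= m -> t \in `[0, T] ->
    (forall s, s \in `[0, T] -> (N (u s \- v s) <= (m * w s)%:E)%E) ->
    (N (P u t \- P v t) <= (m / 2 * w t)%:E)%E.
  move=> uC vC m0 tT uv; have [t0 tT'] := itvP tT.
  have sub := subset_oo tT'.
  have [uL _] := uC; have [vL _] := vC.
  have [PuC Pu] := PP u uC; have [PvC Pv] := PP v vC.
  have BB := Bochner_sub (mD t) (Doo t) (Pu t tT) (Pv t tT).
  have -> : P u t \- P v t = (P u t \- fI) \- (P v t \- fI).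
    by apply/funext => x /=; ring.
  apply: le_trans (L2norm_Bochner (mD t) (Doo t) BB) _.
  have [rm _ _] := BB.
  have muv := measurable_CL2_sub uC vC.
  apply: le_trans (weight_half beta_ge0 mbeta mw w1 wP m0 tT muv _).
    apply: (le_L1L2norm (mD t) (Doo t) rm).
      by apply: emeasurable_funM; exact: measurable_funS sub _.
    move=> s /sub sT; apply: Flip => //; [exact/uL/oo_cc|exact/vL/oo_cc].
  by move=> s /oo_cc sT; rewrite uv// andbT.
pose f := fix f n := if n is m.+1 then P (f m) else (fun=> fI).
have fC n : in_CL2 nu T (f n).
  by elim: n => [|n ih]; [exact: in_CL2_cst|have [] := PP _ ih].
have fL n t : t \in `[0, T] -> f n t \in L2 by move=> tT; have [+ _] := fC n; exact.
have [M M0 fM] : exists2 M : R, 0 <= M & forall n t, t \in `[0, T] ->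
    (N (f n.+1 t \- f n t) <= (M * 2^-1 ^+ n * w t)%:E)%E.
  have [M1 M10 fM1] := in_CL2_bounded (ltW T0) (fC 1%N).
  have [M2 M20 fM2] := in_CL2_bounded (ltW T0) (fC 0%N).
  exists (M1 + M2); first exact: addr_ge0.
  elim => [t tT|n ih t tT].
    apply: le_trans (L2norm_subD (fL 1%N t tT) (fL 0%N t tT)) _.
    apply: le_trans (leeD (fM1 t tT) (fM2 t tT)) _.
    by rewrite -EFinD lee_fin expr0 mulr1 ler_peMr// addr_ge0.
  rewrite exprSr mulrA; apply: (half (f n.+1) (f n)) => //.
  by rewrite mulr_ge0 ?addr_ge0 ?exprn_ge0.
have fmn n k t : t \in `[0, T] ->
    (N (f (k + n)%N t \- f n t) <= (2 * M * 2^-1 ^+ n * (1 - 2^-1 ^+ k) * w t)%:E)%E.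
  move=> tT; elim: k => [|k ih].
    rewrite add0n fun_subrr.
    by rewrite L2norm_cst0 expr0 subrr mulr0 mul0r.
  apply: le_trans (L2norm_subsub (fL _ t tT) (fL n t tT) (fL (k + n)%N t tT)) _.
  apply: le_trans (leeD (fM (k + n)%N t tT) ih) _.
  rewrite -EFinD lee_fin exprD exprS -mulrDl ler_wpM2r//.
  rewrite le_eqVlt; apply/orP; left; apply/eqP.
  by field.
have fmn' n k t : t \in `[0, T] -> (n <= k)%N ->
    (N (f k t \- f n t) <= (2 * M * 2^-1 ^+ n * w t)%:E)%E.
  move=> tT nk; rewrite -(subnK nk); apply: le_trans (fmn _ _ _ tT) _.
  rewrite lee_fin ler_wpM2r// ler_piMr// ?gerBl ?exprn_ge0//.
  by rewrite !mulr_ge0 ?exprn_ge0.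
have small (e : R) : 0 < e -> exists n, 2 * M * 2^-1 ^+ n * K <= e.
  move=> e0; have /cvgrPdist_le/(_ _ e0)[n _ /(_ n (leqnn n))/=] :
      geometric (2 * M * K) 2^-1 @ \oo --> (0 : R).
    by apply: cvg_geometric; rewrite ger0_norm//; lra.
  rewrite sub0r normrN => H; exists n; apply: le_trans H.
  by rewrite mulrAC ler_norm.
have smallw n t : 2 * M * 2^-1 ^+ n * w t <= 2 * M * 2^-1 ^+ n * K.
  by rewrite ler_wpM2l// !mulr_ge0 ?exprn_ge0.
have exg t : exists g, t \in `[0, T] -> g \in L2 /\ N (f n t \- g) @[n --> \oo] --> 0%E.
  have [tT|] := boolP (t \in `[0, T]); last by exists (cst 0).
  have [||g gL fg] := @L2_complete _ _ _ nu (fun n => f n t); last by exists g.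
    by move=> n; exact: fL.
  move=> e e0; have [n ne] := small _ (divr_gt0 e0 (ltr0n _ 2)).
  exists n => k l nk nl.
  apply: le_trans (L2norm_subsub (fL k t tT) (fL l t tT) (fL n t tT)) _.
  rewrite (L2normB nu (f n t)).
  apply: le_trans (leeD (fmn' _ _ _ tT nk) (fmn' _ _ _ tT nl)) _.
  rewrite -EFinD lee_fin (splitr e) lerD//; exact: le_trans (smallw _ _) ne.
have [g gP] := choice exg.
have gL t : t \in `[0, T] -> g t \in L2 by move=> /gP[].
have fg n t : t \in `[0, T] -> (N (g t \- f n t) <= (2 * M * 2^-1 ^+ n * w t)%:E)%E.
  move=> tT; have [_ fgt] := gP t tT.
  have cv : (2 * M * 2^-1 ^+ n * w t)%:E + N (f k t \- g t) @[k --> \oo] -->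
      (2 * M * 2^-1 ^+ n * w t)%:E.
    rewrite -[X in _ --> X]adde0; apply: cvgeD => //; exact: cvg_cst.
  apply: (cvge_to_ge cv); near=> k.
  apply: le_trans (L2norm_subsub (gL t tT) (fL n t tT) (fL k t tT)) _.
  rewrite addeC (L2normB nu (g t)) leeD2r//; apply: fmn' => //.
  by near: k; exact: nbhs_infty_ge.
have gC : in_CL2 nu T g.
  apply: in_CL2P => // t e tT e0.
  have e4 : 0 < e / 4 by rewrite divr_gt0.
  have e2 : 0 < e / 2 by rewrite divr_gt0.
  have [n ne] := small _ e4.
  have [r r0 rP] := in_CL2_ball (fC n) tT e2.
  exists r => // s sT sr.
  apply: le_trans (L2norm_subsub (gL s sT) (gL t tT) (fL n s sT)) _.
  have gs : (N (g s \- f n s) <= (e / 4)%:E)%E.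
    by apply: le_trans (fg n s sT) _; rewrite lee_fin (le_trans (smallw _ _)).
  have gt : (N (f n t \- g t) <= (e / 4)%:E)%E.
    by rewrite L2normB; apply: le_trans (fg n t tT) _; rewrite lee_fin (le_trans (smallw _ _)).
  have := le_trans (L2norm_subsub (fL n s sT) (gL t tT) (fL n t tT))
                   (leeD (rP s sT sr) gt).
  move=> /(leeD gs)/le_trans; apply.
  by rewrite -!EFinD lee_fin; lra.
(* g agrees almost everywhere with its own Picard iterate, which is enough since
   Bochner integrals are defined up to null sets *)
exists g; split => // t tT; have [PgC Pg] := PP g gC.
have [PgL _] := PgC.
apply: (ae_eq_Bochner (mD t) (Doo t) (Pg t tT)).
  by apply: L2_sub => //; exact: gL.
have -> : (P g t \- fI) \- (g t \- fI) = P g t \- g t.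
  by apply/funext => x /=; ring.
apply/eqP; rewrite eq_le L2norm_ge0 andbT; apply/lee_addgt0Pr => e e0; rewrite add0e.
have [n ne] := small _ (divr_gt0 e0 (ltr0n _ 2)).
apply: le_trans (L2norm_subsub (PgL t tT) (gL t tT) (fL n.+1 t tT)) _.
have m0 : 0 <= 2 * M * 2^-1 ^+ n by rewrite !mulr_ge0 ?exprn_ge0.
have H1 := half g (f n) _ t gC (fC n) m0 tT (fun s => @fg n s).
have H2 := fg n.+1 t tT; rewrite L2normB in H2.
apply: le_trans (leeD H1 H2) _.
rewrite -EFinD lee_fin; have := smallw n t; have := ne.
by rewrite exprSr; lra.
Unshelve. all: by end_near. Qed.

End evolution.

(** * Integral operators with a square-integrable kernel *)

Section kernel_operator.
Context {R : realType} {d} {X : measurableType d}.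
Variable nu : {sigma_finite_measure set X -> \bar R}.
Local Notation nu2 := (nu \x nu)%E.
Local Notation L2 := (Lfun nu 2%:E).
Local Notation N := (L2norm nu).
Local Notation LL2 := (Lfun nu2 2%:E).
Local Notation NN := (L2norm nu2).
Implicit Types (b : X * X -> R) (f : X -> R).

(** The integral operator with kernel b. The value at y is 0 by default when the
    integral over z is infinite or undefined; when b and f are square-integrable,
    this happens only for y in a null set. *)
Definition kernel_op b f : X -> R := fun y => \int[nu]_z (b (y, z) * f z).

Lemma measurable_kernel_op b f : measurable_fun setT b -> measurable_fun setT f ->
  measurable_fun setT (kernel_op b f).
Proof.
move=> mb mf; pose g (x : X * X) := (b x * f x.2)%:E.
have mg : measurable_fun setT g.
  apply/measurable_EFinP; apply: measurable_funM => //.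
  exact: measurableT_comp.
apply: measurableT_comp => //.
rewrite (_ : (fun y => _) = (fun y => fubini_F nu (g^\+)%E y - fubini_F nu (g^\-)%E y)%E).
  apply: emeasurable_funB; apply: measurable_fun_fubini_tonelli_F => //.
  - exact: measurable_funepos.
  - exact: measurable_funeneg.
apply/funext => y; rewrite integralE /fubini_F.
by congr (_ - _)%E; apply: eq_integral => z _; rewrite ?funeposE ?funenegE.
Qed.

Lemma ae_section_L2 b : b \in LL2 -> {ae nu, forall y, (fun z => b (y, z)) \in L2}.
Proof.
move=> bL; have := ae_integrable1 (Lfun2_integrable_sqr bL).
apply: filterS => y /integrableP[_ yoo].
have my : measurable_fun setT (fun z => b (y, z)).
  by apply: (measurableT_comp (L2_measurable bL)); exact: measurable_pair1.
apply: L2P => //; rewrite L2normE poweR_lty//.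
apply: le_lt_trans yoo; apply: ge0_le_integral => //.
- by move=> z _; rewrite lee_fin sqr_ge0.
- exact: (measurable_sqr my).
- by apply: measurableT_comp => //; exact: (measurable_sqr my).
- by move=> z _ /=; rewrite lee_fin ler_norm.
Qed.

Lemma kernel_op_section b f y : (fun z => b (y, z)) \in L2 -> f \in L2 ->
  nu.-integrable setT (EFin \o (fun z => b (y, z) * f z)) /\
  (`|kernel_op b f y| <= fine (N (fun z => b (y, z))) * fine (N f)).
Proof.
move=> yL fL; have /Lfun1_integrable yi := Lfun2_mul_Lfun1 yL fL.
split; first exact: yi.
apply: le_trans (le_normr_Rintegral measurableT yi) _.
rewrite -lee_fin EFinM !L2norm_fineK//.
have half2 : 2^-1 + 2^-1 = 1 :> R by lra.
have := hoelder nu (L2_measurable yL) (L2_measurable fL) (ltr0n R 2) (ltr0n R 2) half2.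
rewrite Lnorm1; apply: le_trans.
rewrite /Rintegral fineK; first exact: lexx.
by rewrite integrable_fin_num//; exact: integrable_norm.
Qed.

Lemma kernel_op_bound b f : b \in LL2 -> f \in L2 ->
  kernel_op b f \in L2 /\ (N (kernel_op b f) <= NN b * N f)%E.
Proof.
move=> bL fL.
have mk := measurable_kernel_op (L2_measurable bL) (L2_measurable fL).
suff H : (N (kernel_op b f) <= NN b * N f)%E.
  split => //; apply: L2P => //; apply: le_lt_trans H _.
  by rewrite -(L2norm_fineK bL) -(L2norm_fineK fL) -EFinM ltry.
rewrite -(L2norm_fineK bL) -(L2norm_fineK fL) -EFinM.
have mb2 : measurable_fun setT (fun x => (b x ^+ 2)%:E).
  by apply: measurable_sqr; exact: L2_measurable bL.
have b2_ge0 x : (0 <= (b x ^+ 2)%:E)%E by rewrite lee_fin sqr_ge0.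
have mF := measurable_fun_fubini_tonelli_F (m2 := nu) _ mb2 b2_ge0.
apply/L2norm_leP; first by rewrite mulr_ge0// fine_ge0.
apply: (@le_trans _ _
  (\int[nu]_y (((fine (N f)) ^+ 2)%:E * fubini_F nu (fun x => (b x ^+ 2)%:E) y))%E).
  apply: ae_ge0_le_integral => //.
  - by move=> y _; rewrite lee_fin sqr_ge0.
  - exact: (measurable_sqr mk).
  - by move=> y _; rewrite mule_ge0// ?lee_fin ?sqr_ge0//; exact: integral_ge0.
  - exact: measurable_funeM.
  - apply: filterS (ae_section_L2 bL) => y yL _.
    have [_ ky] := kernel_op_section yL fL.
    rewrite /fubini_F -L2norm_sqr -(L2norm_fineK yL) /= powR_mulrn ?fine_ge0//.
    rewrite -EFinM lee_fin -exprMn mulrC -(real_normK (num_real (kernel_op b f y))).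
    by rewrite ler_sqr ?nnegrE ?mulr_ge0 ?fine_ge0.
rewrite ge0_integralZl_EFin// ?sqr_ge0//; last first.
  by move=> y _; exact: integral_ge0.
rewrite -fubini_tonelli1// -L2norm_sqr -(L2norm_fineK bL) /= powR_mulrn ?fine_ge0//.
by rewrite -EFinM lee_fin -exprMn mulrC.
Qed.

Lemma kernel_op_sub b1 b2 f1 f2 : b1 \in LL2 -> b2 \in LL2 -> f1 \in L2 -> f2 \in L2 ->
  (N (kernel_op b1 f1 \- kernel_op b2 f2) <=
   NN (b1 \- b2) * N f1 + NN b2 * N (f1 \- f2))%E.
Proof.
move=> b1L b2L f1L f2L.
have bL := L2_sub b1L b2L; have fL := L2_sub f1L f2L.
have [k1L _] := kernel_op_bound b1L f1L; have [k2L _] := kernel_op_bound b2L f2L.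
have [kbL kb] := kernel_op_bound bL f1L; have [kfL kf] := kernel_op_bound b2L fL.
apply: le_trans (leeD kb kf); apply: le_trans (L2normD kbL kfL).
rewrite le_eqVlt; apply/orP; left; apply/eqP; apply: ae_eq_L2norm.
- exact: L2_measurable (L2_sub k1L k2L).
- exact: L2_measurable (L2_add kbL kfL).
apply: filterS2 (ae_section_L2 b1L) (ae_section_L2 b2L) => y y1L y2L _ /=.
have yL := L2_sub y1L y2L.
have [i1 _] := kernel_op_section y1L f1L; have [i2 _] := kernel_op_section y2L f2L.
have [i3 _] := @kernel_op_section (b1 \- b2) f1 y yL f1L.
have [i4 _] := kernel_op_section y2L fL.
rewrite /kernel_op -RintegralB// -RintegralD//.
by apply: eq_Rintegral => z _ /=; ring.
Qed.

End kernel_operator.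

(** * Superposition with a Lipschitz function *)

Section superposition.
Context {R : realType} {d} {X : measurableType d}.
Variable nu : {measure set X -> \bar R}.
Local Notation L2 := (Lfun nu 2%:E).
Local Notation N := (L2norm nu).

Lemma lipschitz_bound (sigma : R -> R) : [lipschitz sigma x | x in [set: R]] ->
  exists2 L : R, 0 <= L & forall x y, `|sigma x - sigma y| <= L * `|x - y|.
Proof.
move=> [M0 [_ M0P]].
have M1 : M0 < Num.max M0 0 + 1 by rewrite (@le_lt_trans _ _ (Num.max M0 0)) ?le_max ?lexx// ltrDl.
exists (Num.max M0 0 + 1); first by rewrite addr_ge0// le_max lexx orbT.
by move=> x y; exact: (M0P _ M1 (x, y)).
Qed.

Variables (sigma : R -> R) (L : R).
Hypotheses (L0 : 0 <= L) (sigmaL : forall x y, `|sigma x - sigma y| <= L * `|x - y|).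

Lemma lipschitz_measurable : measurable_fun setT sigma.
Proof.
apply: continuous_measurable_fun => x; apply/cvgrPdist_le => e e0.
have L1 : 0 < L + 1 by rewrite ltr_wpDl.
near=> y; apply: le_trans (sigmaL x y) _.
apply: (@le_trans _ _ ((L + 1) * `|x - y|)); first by rewrite ler_wpM2r// lerDl.
rewrite -ler_pdivlMl//; near: y; apply: cvgr_dist_le => //.
by rewrite mulr_gt0 ?invr_gt0.
Unshelve. all: by end_near. Qed.

Lemma L2norm_superposition h k : h \in L2 -> k \in L2 ->
  (N ((sigma \o h) \- (sigma \o k)) <= L%:E * N (h \- k))%E.
Proof.
move=> hL kL; have hkL := L2_sub hL kL.
have mh := L2_measurable hL; have mk := L2_measurable kL.
rewrite -{1}(ger0_norm L0) -L2normZ//; apply: le_L2norm.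
- by apply: measurable_funB; apply: measurableT_comp => //; exact: lipschitz_measurable.
- by apply: measurable_funM => //; exact: measurable_funB.
- by move=> x /=; rewrite normrM (ger0_norm L0).
Qed.

Lemma superposition_L2 h : (cst (sigma 0) : X -> R) \in L2 -> h \in L2 ->
  sigma \o h \in L2.
Proof.
move=> s0L hL.
have -> : sigma \o h = ((sigma \o h) \- (sigma \o cst 0)) \+ cst (sigma 0).
  by apply/funext => x /=; rewrite subrK.
apply: L2_add => //; apply: L2P.
  by apply: measurable_funB; apply: measurableT_comp => //;
    [exact: lipschitz_measurable|exact: L2_measurable hL|exact: lipschitz_measurable].
apply: le_lt_trans (L2norm_superposition hL (L2_cst0 nu)) _.
by rewrite lte_mul_pinfty// ?lee_fin// L2norm_lty// L2_sub// L2_cst0.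
Qed.

Lemma cst_L2 (c : R) : (`|c|%:E * nu setT < +oo)%E -> (cst c : X -> R) \in L2.
Proof.
have [->|c0] := eqVneq c 0; first by move=> _; exact: L2_cst0.
move=> cnu; apply: L2P => //; rewrite L2normE poweR_lty//.
rewrite [X in (X < _)%E](_ : _ = (c ^+ 2)%:E * nu setT)%E; last by rewrite -integral_cst.
have nuoo : (nu setT < +oo)%E.
  move: cnu; case: (nu setT) (measure_ge0 nu setT) => [r _ _| |]//; first exact: ltry.
  by rewrite mulry gtr0_sg ?normr_gt0// mul1e ltxx.
by rewrite lte_mul_pinfty// lee_fin sqr_ge0.
Qed.

End superposition.

(** * The initial-value problem over a sigma-finite measure space *)

Section initial_value_problem.
Context {R : realType} {d} {X : measurableType d}.
Variable nu : {sigma_finite_measure set X -> \bar R}.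
Local Notation leb := (@lebesgue_measure R).
Local Notation nu2 := (nu \x nu)%E.
Local Notation L2 := (Lfun nu 2%:E).
Local Notation N := (L2norm nu).
Local Notation LL2 := (Lfun nu2 2%:E).
Local Notation NN := (L2norm nu2).

(** The right-hand side of the equation at a fixed time. *)
Definition ivp_field (sigma : R -> R) (a : X -> R) (b : X * X -> R) (f : X -> R) :
  X -> R := sigma \o (a \- kernel_op nu b f).

(** [is_solution], for a sigma-finite measure nu in place of the Lebesgue measure
    on an open set, to which it specializes by definition. *)
Definition ivp_solution (T : R) sigma (a : R -> X -> R) (b : R -> X * X -> R)
    (fI : X -> R) (f : R -> X -> R) :=
  in_CL2 nu T f /\ forall t, t \in `[0, T] ->
    is_Bochner_integral nu `]0, t[%classic
      (fun s => ivp_field sigma (a s) (b s) (f s)) (f t \- fI).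

Variables (T : R) (T0 : 0 < T) (sigma : R -> R) (L : R).
Hypotheses (L0 : 0 <= L) (sigmaL : forall x y, `|sigma x - sigma y| <= L * `|x - y|)
  (s0L : (cst (sigma 0) : X -> R) \in L2).
Local Notation D := `]0%R, T[%classic.

Let mD : measurable (D : set R) := measurable_oo 0 T.
Let Doo : (leb D < +oo)%E := lebesgue_oo_lty 0 T.

Let oo_cc (t : R) : `]0, T[%classic t -> t \in `[0, T].
Proof. by rewrite /= !in_itv/= => /andP[/ltW -> /ltW ->]. Qed.

Lemma ivp_field_L2 a b f : a \in L2 -> b \in LL2 -> f \in L2 ->
  ivp_field sigma a b f \in L2.
Proof.
move=> aL bL fL; have [kL _] := kernel_op_bound bL fL.
exact: (superposition_L2 L0 sigmaL s0L (L2_sub aL kL)).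
Qed.

Lemma ivp_field_sub a1 a2 b1 b2 f1 f2 : a1 \in L2 -> a2 \in L2 ->
  b1 \in LL2 -> b2 \in LL2 -> f1 \in L2 -> f2 \in L2 ->
  (N (ivp_field sigma a1 b1 f1 \- ivp_field sigma a2 b2 f2) <=
   L%:E * (N (a1 \- a2) + NN (b1 \- b2) * N f1) + L%:E * NN b2 * N (f1 \- f2))%E.
Proof.
move=> a1L a2L b1L b2L f1L f2L.
have [k1L _] := kernel_op_bound b1L f1L; have [k2L _] := kernel_op_bound b2L f2L.
apply: le_trans (L2norm_superposition L0 sigmaL (L2_sub a1L k1L) (L2_sub a2L k2L)) _.
rewrite -muleA -ge0_muleDr ?adde_ge0 ?mule_ge0//; apply: lee_wpmul2l => //.
have -> : (a1 \- kernel_op nu b1 f1) \- (a2 \- kernel_op nu b2 f2) =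
    (a1 \- a2) \- (kernel_op nu b1 f1 \- kernel_op nu b2 f2).
  by apply/funext => x /=; ring.
apply: le_trans (L2norm_subD (L2_sub a1L a2L) (L2_sub k1L k2L)) _.
by rewrite -addeA leeD2l// kernel_op_sub.
Qed.

Lemma ivp_field_bound a b f : a \in L2 -> b \in LL2 -> f \in L2 ->
  (N (ivp_field sigma a b f) <=
   N (cst (sigma 0)) + L%:E * N a + L%:E * NN b * N f)%E.
Proof.
move=> aL bL fL.
have zL := L2_cst0 nu; have zzL := L2_cst0 nu2.
have F0 : ivp_field sigma (cst 0) b (cst 0) = cst (sigma 0).
  apply/funext => y; rewrite /ivp_field /kernel_op /=; congr sigma.
  rewrite (_ : (fun z => _) = cst 0) ?Rintegral_cst ?mul0r ?subr0//.
  by apply/funext => z /=; rewrite mulr0.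
have := ivp_field_sub aL zL bL bL fL zL; rewrite F0.
rewrite !fun_subr0 fun_subrr L2norm_cst0 mul0e adde0 => H.
apply: le_trans (L2norm_le_sub (ivp_field_L2 aL bL fL) s0L) _.
by rewrite addeC -addeA leeD2l.
Qed.

Lemma ivp_field_strongly_measurable (a f : R -> X -> R) (b : R -> X * X -> R) :
  strongly_measurable nu D a -> strongly_measurable nu2 D b ->
  strongly_measurable nu D f ->
  strongly_measurable nu D (fun s => ivp_field sigma (a s) (b s) (f s)).
Proof.
move=> am bm fm.
have km : strongly_measurable nu D (fun s => kernel_op nu (b s) (f s)).
  apply: (strongly_measurable_comp2 (F := kernel_op nu) mD Doo _ _ bm fm).
    by move=> h k hL kL; have [] := kernel_op_bound hL kL.
  move=> h k hs ks hL kL hsL ksL hhs kks.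
  apply: (@cvge0_le _ _ _ _ _ (fun n => ((N k + 1) * NN (h \- hs n) + NN h * N (k \- ks n))%E)) => //.
    have /cvge0P := kks => /(_ (fun=> L2norm_ge0 _ _) _ ltr01) kks1.
    near=> n; rewrite L2normB.
    apply: le_trans (kernel_op_sub (hsL n) hL (ksL n) kL) _.
    rewrite (L2normB nu2 h) (L2normB nu k); apply: leeD => //.
    rewrite muleC lee_wpmul2r//.
    apply: le_trans (L2norm_le_sub (ksL n) kL) _.
    rewrite addeC leeD2l// L2normB.
    by near: n; exact: kks1.
  apply: cvge0D; apply: cvge0Zl => //; last exact: L2norm_fin_num.
  by rewrite fin_numD L2norm_fin_num.
apply: (strongly_measurable_comp2 (F := fun h k => sigma \o (h \- k)) mD Doo _ _ am km).
  by move=> h k hL kL; exact: (superposition_L2 L0 sigmaL s0L (L2_sub hL kL)).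
move=> h k hs ks hL kL hsL ksL hhs kks.
apply: (@cvge0_le _ _ _ _ _ (fun n => L%:E * (N (h \- hs n) + N (k \- ks n)))%E) => //.
  apply: nearW => n.
  apply: le_trans (L2norm_superposition L0 sigmaL (L2_sub hL kL) (L2_sub (hsL n) (ksL n))) _.
  apply: lee_wpmul2l => //.
  have -> : (h \- k) \- (hs n \- ks n) = (h \- hs n) \- (k \- ks n).
    by apply/funext => x /=; ring.
  by apply: L2norm_subD; exact: L2_sub.
by apply: cvge0Zl => //; exact: cvge0D.
Unshelve. all: by end_near. Qed.

(** The theory of evolution equations with the Lipschitz constant L |b(s)|. *)
Section rate.
Variable b : R -> X * X -> R.
Hypothesis bI : in_L1L2 nu2 D b.

Let beta (s : R) : \bar R := (L%:E * NN (b s))%E.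

Let beta_ge0 t : (0 <= beta t)%E.
Proof. by rewrite mule_ge0. Qed.

Let mNNb : measurable_fun D (fun t => NN (b t)).
Proof. by have [bm _] := bI; exact: measurable_L2norm_curve. Qed.

Let mbeta : measurable_fun D beta.
Proof. exact: measurable_funeM. Qed.

Let beta_fin t : `]0, T[%classic t -> beta t \is a fin_num.
Proof.
by have [bm _] := bI; move=> /(strongly_measurable_L2 bm) bL; rewrite fin_numM// L2norm_fin_num.
Qed.

Let int_beta : (\int[leb]_(t in `]0%R, T[) beta t = (L * fine (L1L2norm nu2 D b))%:E)%E.
Proof.
rewrite ge0_integralZl_EFin// EFinM fineK// ge0_fin_numE ?L1L2norm_ge0//.
by have [] := bI.
Qed.

Let beta_lty : (\int[leb]_(t in `]0%R, T[) beta t < +oo)%E.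
Proof. by rewrite int_beta ltry. Qed.

(** An arbitrary curve f1 with rate r1 is compared with a solution f2. *)
Lemma ivp_stability (r1 : R -> X -> R) (a : R -> X -> R) (I1 I2 : X -> R) (f1 f2 : R -> X -> R)
    (alpha : R -> \bar R) (A : R) :
  in_CL2 nu T f1 ->
  I1 \in L2 -> I2 \in L2 ->
  (forall t, t \in `[0, T] -> is_Bochner_integral nu `]0, t[%classic r1 (f1 t \- I1)) ->
  ivp_solution T sigma a b I2 f2 ->
  (forall t, (0 <= alpha t)%E) -> measurable_fun D alpha ->
  0 <= A -> (\int[leb]_(t in `]0%R, T[) alpha t <= A%:E)%E ->
  (forall s, `]0, T[%classic s ->
    (N (r1 s \- ivp_field sigma (a s) (b s) (f2 s)) <=
     alpha s + L%:E * NN (b s) * N (f1 s \- f2 s))%E) ->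
  forall t, t \in `[0, T] -> (N (f1 t \- f2 t) <=
    (2 * (fine (N (I1 \- I2)) + A) * expR (4 * (L * fine (L1L2norm nu2 D b))))%:E)%E.
Proof.
move=> f1C I1L I2L B1 [f2C B2] a0 ma A0 aA r12 t tT.
have := evolution_stability T0 beta_ge0 mbeta beta_fin beta_lty
  f1C f2C I1L I2L B1 B2 a0 ma A0 aA r12 tT.
by rewrite int_beta.
Qed.

Lemma ivp_exists a fI : in_L1L2 nu D a -> fI \in L2 ->
  exists f, ivp_solution T sigma a b fI f.
Proof.
move=> [am aoo] fIL; have [bm _] := bI.
apply: (evolution_exists T0 beta_ge0 mbeta beta_fin beta_lty
  (F := fun s p => ivp_field sigma (a s) (b s) p) fIL).
- move=> u uC; apply: ivp_field_strongly_measurable => //.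
  exact: in_CL2_strongly_measurable.
- move=> s p q sT pL qL.
  have aL := strongly_measurable_L2 am sT; have bL := strongly_measurable_L2 bm sT.
  apply: le_trans (ivp_field_sub aL aL bL bL pL qL) _.
  by rewrite !fun_subrr !L2norm_cst0 mul0e adde0 mule0 add0e.
have zL := L2_cst0 nu.
have zm : strongly_measurable nu D (fun=> cst 0 : X -> R).
  by apply: in_CL2_strongly_measurable => //; exact: in_CL2_cst.
have Fm := ivp_field_strongly_measurable am bm zm.
have ma := measurable_L2norm_curve mD Doo am.
apply: (@le_lt_trans _ _ (\int[leb]_(s in D) (N (cst (sigma 0)) + L%:E * N (a s)))%E).
  apply: (le_L1L2norm mD Doo Fm).
    by apply: emeasurable_funD => //; exact: measurable_funeM.
  move=> s sT.
  apply: le_trans (ivp_field_bound (strongly_measurable_L2 am sT) (strongly_measurable_L2 bm sT) zL) _.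
  by rewrite L2norm_cst0 mule0 adde0.
rewrite ge0_integralD//; last 2 first.
- by move=> s _; rewrite mule_ge0.
- exact: measurable_funeM.
rewrite ge0_integralZl_EFin// integral_cst// lte_add_pinfty//.
  by apply: lte_mul_pinfty; [exact: L2norm_ge0|exact: L2norm_fin_num s0L|exact: Doo].
by rewrite lte_mul_pinfty.
Qed.

End rate.

Lemma ivp_lipschitz_initial a b I1 I2 f1 f2 t :
  in_L1L2 nu D a -> in_L1L2 nu2 D b -> I1 \in L2 -> I2 \in L2 ->
  ivp_solution T sigma a b I1 f1 -> ivp_solution T sigma a b I2 f2 ->
  t \in `[0, T] ->
  (N (f1 t \- f2 t) <=
    (2 * expR (4 * (L * fine (L1L2norm nu2 D b))))%:E * N (I1 \- I2))%E.
Proof.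
move=> [am _] bI I1L I2L [f1C B1] sol2 tT; have [bm _] := bI; have [f2C _] := sol2.
have := ivp_stability bI (alpha := cst 0%E) (A := 0) f1C I1L I2L B1 sol2.
move=> /(_ _ _ _ _ _ t tT); rewrite addr0 mulrAC EFinM L2norm_fineK ?L2_sub//; apply => //.
  by rewrite integral0.
move=> s sT; have [f1L _] := f1C; have [f2L _] := f2C.
have aL := strongly_measurable_L2 am sT; have bL := strongly_measurable_L2 bm sT.
apply: le_trans (ivp_field_sub aL aL bL bL (f1L _ (oo_cc sT)) (f2L _ (oo_cc sT))) _.
by rewrite !fun_subrr !L2norm_cst0 mul0e adde0 mule0.
Qed.

Lemma zero_Bochner (E : set R) : measurable E -> (leb E < +oo)%E ->
  is_Bochner_integral nu E (fun=> cst 0) (cst 0).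
Proof.
move=> mE Eoo; have zL := L2_cst0 nu.
have zS : step_curve nu (fun=> cst 0).
  by exists unit, (fun=> tt), (fun=> cst 0); split => // i; rewrite preimage_cst; case: ifPn.
apply/(is_Bochner_stepP _ mE Eoo); split => //; first exact: step_strongly_measurable.
exists (fun=> fun=> cst 0); split => //.
  rewrite /L1L2norm fun_subrr L2norm_cst0.
  by under eq_fun do rewrite integral0; exact: cvg_cst.
apply: (cvge0_le _ _ (cvg_cst 0%E)) => //; apply: nearW => k.
have -> : (fun x : X => \int[leb]_(t in E) (cst 0 : X -> R) x) = cst 0.
  by apply/funext => x; rewrite Rintegral_cst//= mul0r.
by rewrite fun_subrr L2norm_cst0.
Qed.

(** A bound on the solutions that is uniform for a and b in balls, by comparison
    with the zero curve. *)
Lemma ivp_bound a b fI f (A B : R) t :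
  in_L1L2 nu D a -> in_L1L2 nu2 D b -> fI \in L2 ->
  (L1L2norm nu D a <= A%:E)%E -> (L1L2norm nu2 D b <= B%:E)%E ->
  ivp_solution T sigma a b fI f -> t \in `[0, T] ->
  (N (f t) <= (2 * (fine (N fI) + (T * fine (N (cst (sigma 0))) + L * A)) *
    expR (4 * (L * B)))%:E)%E.
Proof.
move=> aI bI fIL aA bB sol tT.
have [am aoo] := aI; have [bm boo] := bI; have [fC fB] := sol.
have zL := L2_cst0 nu.
have ma := measurable_L2norm_curve mD Doo am.
have malpha : measurable_fun D (fun s => N (cst (sigma 0)) + L%:E * N (a s))%E.
  by apply: emeasurable_funD => //; exact: measurable_funeM.
have A0 : 0 <= A by rewrite -lee_fin; apply: le_trans aA; exact: L1L2norm_ge0.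
have c0 : 0 <= T * fine (N (cst (sigma 0))) + L * A.
  by rewrite addr_ge0 ?mulr_ge0// ?fine_ge0// ltW.
have zB r : r \in `[0, T] ->
    is_Bochner_integral nu `]0, r[%classic (fun=> cst 0) (cst 0 \- cst 0).
  move=> _; rewrite fun_subrr.
  by apply: zero_Bochner; [exact: measurable_oo|exact: lebesgue_oo_lty].
have sub0 (h : X -> R) : cst 0 \- h = \- h by apply/funext => x /=; rewrite sub0r.
have := ivp_stability bI (in_CL2_cst T zL) zL fIL zB sol _ malpha c0 _ _ tT.
rewrite !sub0 !L2normN => H.
apply: (le_trans (H _ _ _)).
- by move=> s; rewrite adde_ge0 ?mule_ge0.
- rewrite ge0_integralD//; last 2 first.
    by move=> s _; rewrite mule_ge0.
    exact: measurable_funeM.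
  rewrite ge0_integralZl_EFin// integral_cst// (EFinD (T * _)); apply: leeD.
    rewrite (EFinM T) L2norm_fineK// muleC.
    have lebD : (leb D <= T%:E)%E by rewrite lebesgue_measure_itv/= lte_fin T0 oppr0 adde0.
    by apply: lee_wpmul2r; [exact: L2norm_ge0|exact: lebD].
  by rewrite EFinM lee_wpmul2l.
- move=> s sT; have [fL _] := fC.
  rewrite !sub0 !L2normN.
  exact: ivp_field_bound (strongly_measurable_L2 am sT) (strongly_measurable_L2 bm sT)
    (fL _ (oo_cc sT)).
rewrite lee_fin ler_wpM2l//.
  by rewrite mulr_ge0// addr_ge0// fine_ge0.
rewrite ler_expR ler_pM2l// ler_wpM2l// -lee_fin fineK//.
by rewrite ge0_fin_numE// L1L2norm_ge0.
Qed.

Lemma ivp_lipschitz_params a1 a2 b1 b2 fI f1 f2 (A B M : R) t :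
  in_L1L2 nu D a1 -> in_L1L2 nu2 D b1 -> in_L1L2 nu D a2 -> in_L1L2 nu2 D b2 ->
  fI \in L2 ->
  (L1L2norm nu D a1 <= A%:E)%E -> (L1L2norm nu2 D b1 <= B%:E)%E ->
  (L1L2norm nu2 D b2 <= B%:E)%E ->
  ivp_solution T sigma a1 b1 fI f1 -> ivp_solution T sigma a2 b2 fI f2 ->
  M = 2 * (fine (N fI) + (T * fine (N (cst (sigma 0))) + L * A)) *
    expR (4 * (L * B)) -> t \in `[0, T] ->
  (N (f1 t \- f2 t) <= (2 * L * (1 + M) * expR (4 * (L * B)))%:E *
    (L1L2norm nu D (fun t => a1 t \- a2 t)%R +
     L1L2norm nu2 D (fun t => b1 t \- b2 t)%R))%E.
Proof.
move=> a1I b1I a2I b2I fIL a1A b1B b2B sol1 sol2 ME tT.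
have [a1m a1oo] := a1I; have [b1m b1oo] := b1I.
have [a2m a2oo] := a2I; have [b2m b2oo] := b2I.
have [f1C B1] := sol1; have [f2C B2] := sol2.
have A0 : 0 <= A by rewrite -lee_fin; apply: le_trans a1A; exact: L1L2norm_ge0.
have M0 : 0 <= M.
  by rewrite ME !mulr_ge0 ?expR_ge0// !addr_ge0 ?mulr_ge0 ?fine_ge0// ltW.
have am : strongly_measurable nu D (fun t => a1 t \- a2 t).
  exact: strongly_measurable_sub.
have bm : strongly_measurable nu2 D (fun t => b1 t \- b2 t).
  exact: strongly_measurable_sub.
have mNa := measurable_L2norm_curve mD Doo am.
have mNb := measurable_L2norm_curve mD Doo bm.
have Pa_fin : L1L2norm nu D (fun t => a1 t \- a2 t) \is a fin_num.
  rewrite ge0_fin_numE ?L1L2norm_ge0//.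
  apply: (@le_lt_trans _ _ (L1L2norm nu D a1 + L1L2norm nu D a2)%E).
    apply: le_L1L2normD => // s sT.
    by apply: L2norm_subD; [exact: strongly_measurable_L2 a1m sT|exact: strongly_measurable_L2 a2m sT].
  exact: lte_add_pinfty.
have Pb_fin : L1L2norm nu2 D (fun t => b1 t \- b2 t) \is a fin_num.
  rewrite ge0_fin_numE ?L1L2norm_ge0//.
  apply: (@le_lt_trans _ _ (L1L2norm nu2 D b1 + L1L2norm nu2 D b2)%E).
    apply: le_L1L2normD => // s sT.
    by apply: L2norm_subD; [exact: strongly_measurable_L2 b1m sT|exact: strongly_measurable_L2 b2m sT].
  exact: lte_add_pinfty.
set Pa := L1L2norm nu D _ in Pa_fin *; set Pb := L1L2norm nu2 D _ in Pb_fin *.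
have Pa0 : 0 <= fine Pa by rewrite fine_ge0// L1L2norm_ge0.
have Pb0 : 0 <= fine Pb by rewrite fine_ge0// L1L2norm_ge0.
pose alpha s := (L%:E * (N (a1 s \- a2 s) + M%:E * NN (b1 s \- b2 s)))%E.
have malpha : measurable_fun D alpha.
  by apply: measurable_funeM; apply: emeasurable_funD => //; exact: measurable_funeM.
have c0 : 0 <= L * (fine Pa + M * fine Pb) by rewrite mulr_ge0 ?addr_ge0 ?mulr_ge0.
have := ivp_stability b2I f1C fIL fIL B1 sol2 _ malpha c0 _ _ tT.
rewrite fun_subrr L2norm_cst0 add0r => H; apply: (le_trans (H _ _ _)).
- by move=> s; rewrite mule_ge0 ?adde_ge0 ?mule_ge0.
- rewrite ge0_integralZl_EFin//; last 2 first.
    by move=> s _; rewrite adde_ge0 ?mule_ge0.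
    by apply: emeasurable_funD => //; exact: measurable_funeM.
  rewrite EFinM lee_wpmul2l// ge0_integralD//; last 2 first.
    by move=> s _; rewrite mule_ge0.
    exact: measurable_funeM.
  by rewrite ge0_integralZl_EFin// EFinD EFinM !fineK.
- move=> s sT; have [f1L _] := f1C; have [f2L _] := f2C; have sT' := oo_cc sT.
  apply: le_trans (ivp_field_sub (strongly_measurable_L2 a1m sT)
    (strongly_measurable_L2 a2m sT) (strongly_measurable_L2 b1m sT)
    (strongly_measurable_L2 b2m sT) (f1L _ sT') (f2L _ sT')) _.
  rewrite leeD2r// lee_wpmul2l// leeD2l// muleC lee_wpmul2r//.
  by rewrite ME; exact: ivp_bound sol1 sT'.
rewrite -(fineK Pa_fin) -(fineK Pb_fin) -EFinD -EFinM lee_fin /=.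
set E1 := expR (4 * (L * fine _)); set E2 := expR (4 * (L * B)).
have E12 : E1 <= E2.
  rewrite ler_expR ler_pM2l// ler_wpM2l// -lee_fin fineK//.
  by rewrite ge0_fin_numE// L1L2norm_ge0.
have E10 : 0 <= E1 by exact: expR_ge0.
have E20 : 0 <= E2 by exact: expR_ge0.
apply: (@le_trans _ _ (2 * (L * (fine Pa + M * fine Pb)) * E2)).
  by rewrite ler_wpM2l// mulr_ge0.
rewrite [leRHS](_ : _ = 2 * (L * ((1 + M) * (fine Pa + fine Pb))) * E2); last by ring.
rewrite ler_wpM2r// ler_wpM2l// ler_wpM2l//.
by rewrite mulrDl mul1r mulrDr; have := mulr_ge0 M0 Pa0; lra.
Qed.

End initial_value_problem.

(** * Well-posedness *)

Theorem theorem1 (R : realType) (d : nat) (Y : set 'rV[R]_d) (oY : open Y)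
    (T : R) (T_gt0 : 0 < T)
    (fI : 'rV[R]_d -> R) (hfI : fI \in Lfun (lebesgue_on oY) 2%:E)
    (sigma : R -> R) (sigma_lip : [lipschitz sigma x | x in [set: R]])
    (sigma0 : (`|sigma 0|%:E * lebesgue_rV d Y < +oo)%E)
    (a : R -> 'rV[R]_d -> R) (b : R -> 'rV[R]_d * 'rV[R]_d -> R)
    (hab : in_params oY T a b) :
  [/\ exists f, is_solution oY T sigma a b fI f /\
        forall g, is_solution oY T sigma a b fI g ->
          forall t, t \in `[0, T] -> f t = g t %[ae lebesgue_on oY],
      exists K : R, forall (gI1 gI2 : 'rV[R]_d -> R) (f1 f2 : R -> 'rV[R]_d -> R),
        gI1 \in Lfun (lebesgue_on oY) 2%:E ->
        gI2 \in Lfun (lebesgue_on oY) 2%:E ->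
        is_solution oY T sigma a b gI1 f1 ->
        is_solution oY T sigma a b gI2 f2 ->
        (CL2norm (lebesgue_on oY) T (fun t => f1 t \- f2 t)%R <=
          K%:E * L2norm (lebesgue_on oY) (gI1 \- gI2)%R)%E &
      exists r K : R, 0 < r /\
        forall (a1 a2 : R -> 'rV[R]_d -> R)
          (b1 b2 : R -> 'rV[R]_d * 'rV[R]_d -> R) (f1 f2 : R -> 'rV[R]_d -> R),
        in_params oY T a1 b1 ->
        in_params oY T a2 b2 ->
        (params_norm oY T (fun t => a1 t \- a t)%R (fun t => b1 t \- b t)%R
          < r%:E)%E ->
        (params_norm oY T (fun t => a2 t \- a t)%R (fun t => b2 t \- b t)%R
          < r%:E)%E ->
        is_solution oY T sigma a1 b1 fI f1 ->
        is_solution oY T sigma a2 b2 fI f2 ->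
        (CL2norm (lebesgue_on oY) T (fun t => f1 t \- f2 t)%R <=
          K%:E * params_norm oY T (fun t => a1 t \- a2 t)%R
                                  (fun t => b1 t \- b2 t)%R)%E].
Proof.
have [L L0 sigmaL] := lipschitz_bound sigma_lip.
have muYE : lebesgue_on oY setT = lebesgue_rV d Y by rewrite /lebesgue_on /mrestr setTI.
have s0L : (cst (sigma 0) : 'rV[R]_d -> R) \in Lfun (lebesgue_on oY) 2%:E.
  by apply: cst_L2; move: sigma0; rewrite -muYE.
have [aI bI] := hab.
set D := `]0%R, T[%classic in aI bI.
have CL2norm_le (f : R -> 'rV[R]_d -> R) (c : \bar R) :
    (forall t, t \in `[0, T] -> (L2norm (lebesgue_on oY) (f t) <= c)%E) ->
    (CL2norm (lebesgue_on oY) T f <= c)%E.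
  by move=> fc; apply/ereal_supP => _ [t tT <-]; exact: fc.
split.
- have [f fsol] := ivp_exists T_gt0 L0 sigmaL s0L bI aI hfI.
  exists f; split => // g gsol t tT.
  have := ivp_lipschitz_initial T_gt0 L0 sigmaL aI bI hfI hfI fsol gsol tT.
  rewrite fun_subrr L2norm_cst0 mule0 => fg.
  have [[fL _] _] := fsol; have [[gL _] _] := gsol.
  have /L2norm_eq0 : L2norm (lebesgue_on oY) (f t \- g t) = 0%E.
    by apply/eqP; rewrite eq_le fg L2norm_ge0.
  move=> /(_ (L2_sub (fL t tT) (gL t tT))).
  by apply: filterS => x /(_ I) /= /eqP; rewrite subr_eq0 => /eqP.
- exists (2 * expR (4 * (L * fine (L1L2norm (lebesgue_on oY \x lebesgue_on oY)%E D b)))).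
  move=> gI1 gI2 f1 f2 gI1L gI2L sol1 sol2; apply: CL2norm_le => t tT.
  exact: (ivp_lipschitz_initial T_gt0 L0 sigmaL aI bI gI1L gI2L sol1 sol2 tT).
- pose Na := fine (L1L2norm (lebesgue_on oY) D a).
  pose Nb := fine (L1L2norm (lebesgue_on oY \x lebesgue_on oY)%E D b).
  pose M := 2 * (fine (L2norm (lebesgue_on oY) fI) +
    (T * fine (L2norm (lebesgue_on oY) (cst (sigma 0))) + L * (Na + 1))) *
    expR (4 * (L * (Nb + 1))).
  exists 1, (2 * L * (1 + M) * expR (4 * (L * (Nb + 1)))); split; first exact: ltr01.
  (* in the unit ball around (a, b), the norms of the parameters are at most
     one more than those of a and b *)
  have ball1 d' (X : measurableType d') (nu : {measure set X -> \bar R})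
      (u v : R -> X -> R) : in_L1L2 nu D u -> in_L1L2 nu D v ->
      (L1L2norm nu D (fun t => v t \- u t)%R <= 1%:E)%E ->
      (L1L2norm nu D v <= (fine (L1L2norm nu D u) + 1)%:E)%E.
    move=> [um uoo] [vm _] vu1.
    rewrite EFinD fineK ?ge0_fin_numE ?L1L2norm_ge0// addeC.
    apply: le_trans (leeD2r _ vu1).
    have mD := measurable_oo 0 T; have Doo := lebesgue_oo_lty 0 T.
    apply: (le_L1L2normD mD Doo) => //; first exact: strongly_measurable_sub.
    move=> t tT; apply: L2norm_le_sub.
      exact: strongly_measurable_L2 vm tT.
    exact: strongly_measurable_L2 um tT.
  have leparams a' b' :
      (params_norm oY T (fun t => a' t \- a t)%R (fun t => b' t \- b t)%R < 1%:E)%E ->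
      (L1L2norm (lebesgue_on oY) D (fun t => a' t \- a t)%R <= 1%:E)%E /\
      (L1L2norm (lebesgue_on oY \x lebesgue_on oY)%E D (fun t => b' t \- b t)%R <= 1%:E)%E.
    move=> /ltW ab1; split; apply: le_trans ab1.
      by rewrite leeDl// L1L2norm_ge0.
    by rewrite leeDr// L1L2norm_ge0.
  move=> a1 a2 b1 b2 f1 f2 [a1I b1I] [a2I b2I] /leparams[a1a b1b] /leparams[_ b2b].
  move=> sol1 sol2; apply: CL2norm_le => t tT.
  exact: (ivp_lipschitz_params T_gt0 L0 sigmaL s0L a1I b1I a2I b2I hfI
    (ball1 _ _ _ _ _ aI a1I a1a) (ball1 _ _ _ _ _ bI b1I b1b)
    (ball1 _ _ _ _ _ bI b2I b2b) sol1 sol2 erefl tT).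
Qed.
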